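(* Let the parameters $a,b_i,c_i$ be indeterminates, or complex numbers satisfying $\beta_{0,i},\beta_{1,i},\gamma_v\notin\mathbb{Z}$ for all $1\le i\le m$, $v\in\mathbb{Z}_2^m$. Let $\varPhi={}^t(\dots,\varphi_v,\dots)$ be the column vector of the $\varphi_v$ ($v\in\mathbb{Z}_2^m$), arrayed by the total order on $\mathbb{Z}_2^m$. The map $\nabla_X:\mathcal{H}^m(\nabla_T)\to\mathcal{H}^{m,1}(\nabla_T)$ is represented by the frame $\{\varphi_v\}_{v\in\mathbb{Z}_2^m}$ of $\mathcal{H}^m(\nabla_T)$ as $\nabla_X\varPhi=\Xi_\varPhi\wedge\varPhi$, where $$\Xi_\varPhi=\sum_{k=1}^m(1-c_k)\,\mathrm{id}_{2^m}\frac{dx_k}{x_k}+\sum_{k=1}^m\sum_{v\in\mathbb{Z}_2^m,\ v_k=0}(\beta_{1,k}\Pi\beta_v)\,C\;{}^t(f_v-f_{\sigma_k\cdot v})(e_v-e_{\sigma_k\cdot v})\frac{dx_k}{x_k}+\sum_{v\in\mathbb{Z}_2^m}(-a\,\Pi\beta_v)\,C\;{}^tf_v\,f_v\,\frac{d(1-v\,{}^tx)}{1-v\,{}^tx},$$ and $\mathrm{id}_{2^m}$ is the unit matrix of size $2^m$.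
   Context: Setting. $m\ge1$; $\mathbb{Z}_2=\{0,1\}\subset\mathbb{N}$; $t=(t_1,\dots,t_m)$, $x=(x_1,\dots,x_m)$; $v\,{}^tx=\sum_iv_ix_i$, $t\,{}^tx=\sum_it_ix_i$; $|v|=\sum_iv_i$. Parameters $a,b_i,c_i$ ($1\le i\le m$); $\beta_{0,i}=b_i$, $\beta_{1,i}=c_i-1-b_i$, $\gamma_v=a-\sum_iv_ic_i+|v|$; $\Sigma\beta_v=\sum_i\beta_{v_i,i}$, $\Pi\beta_v=\prod_i\beta_{v_i,i}$. The base field is $\mathbb{C}(\alpha)=\mathbb{C}(a,b_1,\dots,b_m,c_1,\dots,c_m)$ (replaced by $\mathbb{C}$ when complex values are assigned). $\sigma_j\cdot v$ is $v$ with $v_j$ replaced by $1-v_j$. Let $X=\{x\in\mathbb{C}^m\mid\prod_ix_i\prod_{v\in\mathbb{Z}_2^m}(1-v\,{}^tx)\neq0\}$, $\widetilde X=\{(t,x)\in\mathbb{C}^m\times X\mid(1-t\,{}^tx)\prod_it_i(1-t_i)\ne0\}$, $\widetilde S=(\mathbb{P}^1)^{2m}-\widetilde X$. $\Omega^{p,q}_{\widetilde X}( *\widetilde S)$ is the space of rational $(p+q)$-forms on $\widetilde X$ with poles only along $\widetilde S$, of degree $p$ in the $dt_i$ and $q$ in the $dx_i$. Put $dT=dt_1\wedge\cdots\wedge dt_m$, $$\omega_T=\sum_{i=1}^m\Big(\frac{\beta_{0,i}}{t_i}+\frac{\beta_{1,i}}{t_i-1}+\frac{ax_i}{1-t\,{}^tx}\Big)dt_i,\quad\omega_X=\sum_{i=1}^m\frac{at_i}{1-t\,{}^tx}dx_i,$$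 $\nabla_T=d_T+\omega_T\wedge$, $\nabla_X=d_X+\omega_X\wedge$ ($d_T,d_X$ exterior derivations in $t$, $x$). $\mathcal{H}^m(\nabla_T)=\Omega^{m,0}_{\widetilde X}( *\widetilde S)/\nabla_T(\Omega^{m-1,0}_{\widetilde X}( *\widetilde S))$, $\mathcal{H}^{m,1}(\nabla_T)=\Omega^{m,1}_{\widetilde X}( *\widetilde S)/\nabla_T(\Omega^{m-1,1}_{\widetilde X}( *\widetilde S))$. Since $\nabla_T\nabla_X+\nabla_X\nabla_T=0$, $\nabla_X$ induces a map $\mathcal{H}^m(\nabla_T)\to\mathcal{H}^{m,1}(\nabla_T)$. $\varphi_v=dT/\prod_{i=1}^m(t_i-v_i)$ for $v\in\mathbb{Z}_2^m$; their classes form a frame of $\mathcal{H}^m(\nabla_T)$. Total order: $v>w$ iff $v\neq w$ and either $|v|>|w|$, or $|v|=|w|$ and $v_i<w_i$ for the minimum index $i$ with $v_i\ne w_i$. Vectors and matrices are arrayed increasingly in this order (starting from $(0,\dots,0)$). Partial order: $v\succeq w$ iff ($w_i=1\Rightarrow v_i=1$); $v\succ w$ iff $v\succeq w$, $v\ne w$. $e_v$ is the unit row vector of size $2^m$ with $\varphi_v=e_v\varPhi$, and $$f_v=\frac{a-\Sigma\beta_v}{a}e_v-\sum_{j=1}^m\frac{\beta_{1-v_j,j}}{a}e_{\sigma_j\cdot v}.$$ The matrix $C=(C_{v,v'})$ is $$C_{v,v'}=\sum_{w\in\mathbb{Z}_2^m}A_w\prod_{1\le i\le m,\ w_i=0}\frac{\delta(v_i,v_i')}{\beta_{v_i,i}},$$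 with $\delta$ Kronecker's symbol, empty products equal to $1$, and for $|w|=r$, $A_w=\sum 1/\prod_{j=1}^r\gamma_{w^{(j)}}$, summed over the $r!$ sequences $w=w^{(r)}\succ w^{(r-1)}\succ\cdots\succ w^{(1)}\succ(0,\dots,0)$ with $|w^{(j)}|=j$ (so $A_{(0,\dots,0)}=1$). For $v=(0,\dots,0)$ the form $d(1-v\,{}^tx)$ is $0$. *)

(* Defs.v *)
From HB Require Import structures.
From mathcomp Require Import all_boot all_order all_algebra.
From mathcomp Require Import generic_quotient fraction complex.
From mathcomp Require Import mpoly ring.
From mathcomp Require Import boolp classical_sets reals.

Set Implicit Arguments.
Unset Strict Implicit.
Unset Printing Implicit Defensive.

Import GRing.Theory.

Local Open Scope ring_scope.
Local Open Scope quotient_scope.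

Notation Z2 m := {ffun 'I_m -> bool}.

Section Index.
Variable m : nat.
Implicit Types v w : Z2 m.

Definition zvec : Z2 m := [ffun=> false].
Definition wt v : nat := (\sum_i v i)%N.
Definition flip (j : 'I_m) v : Z2 m := [ffun i => if i == j then ~~ v i else v i].

Definition gtv v w : bool :=
  (wt w < wt v)%N
  || ((wt v == wt w)
      && [exists i, [&& ~~ v i, w i & [forall j : 'I_m, (j < i)%N ==> (v j == w j)]]]).
Definition lev v w : bool := (v == w) || gtv w v.

(* The j-th vertex, for the increasing array of Z_2^m along the total order. *)
Definition vtx (j : 'I_(2 ^ m)) : Z2 m := nth zvec (sort lev (enum {: Z2 m})) j.

Definition psucc v w : bool := (v != w) && [forall i, w i ==> v i].

(* s = (w^(1), ..., w^(r)) with w = w^(r) > ... > w^(1) > 0 for the partial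
   order, and |w^(j)| = j. *)
Definition is_chain w (s : (wt w).-tuple (Z2 m)) : bool :=
  [&& path (fun u v => psucc v u) zvec s,
      last zvec s == w
    & [forall j : 'I_(wt w), wt (tnth s j) == j.+1]].

End Index.

Section Matrices.
Variables (K : fieldType) (m : nat) (a : K) (b c : 'I_m -> K).
Implicit Types v w : Z2 m.

Definition beta (e : bool) (i : 'I_m) : K := if e then c i - 1 - b i else b i.
Definition gamma v : K := a - \sum_i (v i)%:R * c i + (wt v)%:R.
Definition sumbeta v : K := \sum_i beta (v i) i.
Definition prodbeta v : K := \prod_i beta (v i) i.

Definition evec v : 'rV[K]_(2 ^ m) := \row_j (vtx j == v)%:R.
Definition fvec v : 'rV[K]_(2 ^ m) :=
  ((a - sumbeta v) / a) *: evec v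
  - \sum_j (beta (~~ v j) j / a) *: evec (flip j v).

Definition Acoef w : K :=
  \sum_(s : (wt w).-tuple (Z2 m) | is_chain s) (\prod_(u <- s) gamma u)^-1.
Definition Ccoef v v' : K :=
  \sum_w Acoef w * \prod_(i | ~~ w i) ((v i == v' i)%:R / beta (v i) i).
Definition Cmx : 'M[K]_(2 ^ m) := \matrix_(i, j) Ccoef (vtx i) (vtx j).

End Matrices.

(* The variables of index lshift m i are the t_i, those of index rshift m i
   are the x_i. *)
Notation ratfun K m := {fraction {mpoly K[m + m]}}.

Section RationalFunctions.
Variables (K : fieldType) (m : nat).
Local Notation F := (ratfun K m).

Definition cst (k : K) : F := FracField.tofrac (k%:MP_[m + m]).
Definition zvar (j : 'I_(m + m)) : F := FracField.tofrac 'X_j.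
Definition tvar (i : 'I_m) : F := zvar (lshift m i).
Definition xvar (i : 'I_m) : F := zvar (rshift m i).

(* The partial derivative with respect to the variable j, by the quotient
   rule; by pderiv_frac it does not depend on the representative. *)
Definition pderiv (j : 'I_(m + m)) (f : F) : F :=
  let n := \n_(repr f) in let d := \d_(repr f) in
  FracField.tofrac (n^`M(j) * d - n * d^`M(j)) / FracField.tofrac (d ^+ 2).

Definition one_minus_tx : F := 1 - \sum_i tvar i * xvar i.
Definition one_minus_vx (v : Z2 m) : F := 1 - \sum_i (v i)%:R * xvar i.

(* X~ is the complement of the zero locus of polar in affine 2m-space, so the
   rational functions on (P^1)^(2m) with poles only along S~ are the p / polar^n. *)
Definition polar : F :=
  one_minus_tx * \prod_i (tvar i * (1 - tvar i))
  * (\prod_i xvar i * \prod_(v : Z2 m) one_minus_vx v).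
Definition regular : set F :=
  [set f | exists (p : {mpoly K[m + m]}) (n : nat),
             f = FracField.tofrac p / polar ^+ n].

End RationalFunctions.

Section PderivTheory.
Variables (K : fieldType) (m : nat).

Lemma frac_repr (f : ratfun K m) :
  f = FracField.tofrac \n_(repr f) / FracField.tofrac \d_(repr f).
Proof.
rewrite -{1}[f]reprK; set r := repr f.
have dr : \d_r != 0 by exact: denom_ratioP.
rewrite /GRing.inv/= /GRing.mul/= !piE.
apply/eqP; rewrite FracField.equivf_def.
by rewrite /FracField.mulf /FracField.invf !numden_Ratio ?oner_neq0 ?mulr1 ?mul1r // mulrC.
Qed.

Lemma pderiv_frac (j : 'I_(m + m)) (n d : {mpoly K[m + m]}) : d != 0 ->
  pderiv j (FracField.tofrac n / FracField.tofrac d)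
  = FracField.tofrac (n^`M(j) * d - n * d^`M(j)) / FracField.tofrac (d ^+ 2).
Proof.
move=> d0; rewrite /pderiv; set f := FracField.tofrac n / _.
have dr : \d_(repr f) != 0 by exact: denom_ratioP.
have := frac_repr f.
move: (\n_(repr f)) (\d_(repr f)) dr => n' d' d'0 /eqP.
rewrite /f eqr_div ?tofrac_eq0 // -!tofracM tofrac_eq => /eqP E.
apply/eqP; rewrite eqr_div ?tofrac_eq0 ?expf_neq0 // -!tofracM tofrac_eq; apply/eqP.
have := congr1 (mderiv j) E; rewrite !mderivM.
move: (mderiv j n) (mderiv j d) (mderiv j n') (mderiv j d') => nj dj n'j d'j D.
apply: subr0_eq.
transitivity (- (d * d') * (nj * d' + n * d'j - (n'j * d + n' * dj))
  + (dj * d' + d * d'j) * (n * d' - n' * d)); last first.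
  by rewrite D E !subrr !mulr0 addr0.
by ring.
Qed.

End PderivTheory.

(* A form is the family of its coefficients on the basis
   dz_I = dz_(i_1) /\ ... /\ dz_(i_k), where I = {i_1 < ... < i_k} and
   (z_0, ..., z_(2m-1)) = (t_1, ..., t_m, x_1, ..., x_m). *)
Notation form K m := {ffun {set 'I_(m + m)} -> (ratfun K m)^o}.

Section Forms.
Variables (K : fieldType) (m : nat).
Local Notation F := (ratfun K m).
Local Notation form := (form K m).

Definition dzset (I : {set 'I_(m + m)}) : form := [ffun J => (J == I)%:R].
Definition dt (i : 'I_m) : form := dzset [set lshift m i].
Definition dx (i : 'I_m) : form := dzset [set rshift m i].
Definition fun_form (g : F) : form := g *: dzset finset.set0.

(* dz_I /\ dz_J = (-1) ^ (inversions I J) dz_(I U J) when I and J are disjoint. *)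
Definition inversions (I J : {set 'I_(m + m)}) : nat :=
  #|[set ij | [&& ij.1 \in I, ij.2 \in J & (ij.2 < ij.1)%N]]|.
Definition wedge (u w : form) : form :=
  [ffun L : {set 'I_(m + m)} => \sum_(I : {set 'I_(m + m)} | I \subset L)
     (-1) ^+ inversions I (L :\: I)%SET * (u I * w (L :\: I)%SET) : F].

Definition pderiv_form (j : 'I_(m + m)) (w : form) : form :=
  [ffun I : {set 'I_(m + m)} => pderiv j (w I)].
Definition extT (w : form) : form :=
  \sum_i wedge (dt i) (pderiv_form (lshift m i) w).
Definition extX (w : form) : form :=
  \sum_i wedge (dx i) (pderiv_form (rshift m i) w).

Definition tdeg (I : {set 'I_(m + m)}) : nat := #|[set i | lshift m i \in I]|.
Definition xdeg (I : {set 'I_(m + m)}) : nat := #|[set i | rshift m i \in I]|.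

Definition Omega (p q : nat) : set form :=
  [set w | forall I : {set 'I_(m + m)},
     regular (w I) /\ (w I != 0 -> tdeg I = p /\ xdeg I = q)].

Definition dlog (g : F) : form := g^-1 *: (extT (fun_form g) + extX (fun_form g)).

Definition dT : form := \big[wedge/fun_form 1]_(i < m) dt i.
Definition phi (v : Z2 m) : form :=
  (\prod_i (tvar K i - (v i)%:R))^-1 *: dT.
Definition Phi : 'cV[form]_(2 ^ m) := \col_j phi (vtx j).

Definition tensor (M : 'M[K]_(2 ^ m)) (w : form) : 'M[form]_(2 ^ m) :=
  map_mx (fun k : K => cst m k *: w) M.
Definition wedgemx (M : 'M[form]_(2 ^ m)) (U : 'cV[form]_(2 ^ m)) :
    'cV[form]_(2 ^ m) :=
  \col_i \sum_j wedge (M i j) (U j 0).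

End Forms.

Section Connection.
Variables (K : fieldType) (m : nat) (a : K) (b c : 'I_m -> K).
Local Notation form := (form K m).
Local Notation t_ := (@tvar K m).
Local Notation x_ := (@xvar K m).

Definition omegaT : form :=
  \sum_i (cst m (beta b c false i) / t_ i + cst m (beta b c true i) / (t_ i - 1)
          + cst m a * x_ i / one_minus_tx K m) *: dt K i.
Definition omegaX : form :=
  \sum_i (cst m a * t_ i / one_minus_tx K m) *: dx K i.
Definition nablaT (w : form) : form := extT w + wedge omegaT w.
Definition nablaX (w : form) : form := extX w + wedge omegaX w.

Definition exactT (q : nat) : set form := (nablaT @` Omega m.-1 q)%classic.

(* The class of w in Omega^(m,q) / nablaT (Omega^(m-1,q)), as a coset; for
   q = 0 and q = 1 the quotient is H^m(nablaT) and H^(m,1)(nablaT). *)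
Definition class (q : nat) (w : form) : set form := [set w' | exactT q (w' - w)]%classic.

(* The map H^m(nablaT) -> H^(m,1)(nablaT) induced by nablaX, on cosets:
   u is sent to nablaX u + nablaT (Omega^(m-1,1)). *)
Definition nablaXH (u : set form) : set form :=
  [set w' | exists2 w, u w & exactT 1 (w' - nablaX w)]%classic.

Definition Xi : 'M[form]_(2 ^ m) :=
  \sum_k tensor ((1 - c k)%:M) ((x_ k)^-1 *: dx K k)
  + \sum_k \sum_(v : Z2 m | ~~ v k)
      tensor ((beta b c true k * prodbeta b c v) *:
                (Cmx a b c *m (fvec a b c v - fvec a b c (flip k v))^T
                 *m (evec K v - evec K (flip k v))))
             ((x_ k)^-1 *: dx K k)
  + \sum_(v : Z2 m)
      tensor ((- a * prodbeta b c v) *: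
                (Cmx a b c *m (fvec a b c v)^T *m fvec a b c v))
             (dlog (one_minus_vx K v)).

Definition connection_formula : Prop :=
  forall j : 'I_(2 ^ m),
    nablaXH (class 0 (Phi K m j 0)) = class 1 (wedgemx Xi (Phi K m) j 0).

End Connection.

Section Indeterminates.
Variables (k : fieldType) (m : nat).

Notation param_field := {fraction {mpoly k[1 + (m + m)]}}.
Definition indet_a : param_field :=
  FracField.tofrac 'X_(lshift (m + m) (@ord0 0)).
Definition indet_b (i : 'I_m) : param_field :=
  FracField.tofrac 'X_(rshift 1 (lshift m i)).
Definition indet_c (i : 'I_m) : param_field :=
  FracField.tofrac 'X_(rshift 1 (rshift m i)).

End Indeterminates.

(* Main.v *)
(* On coefficients, nabla_T and nabla_X are sums of dz_j /\ D_j with commuting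
   operators D_j = d_j + omega_j, hence they anticommute, and nabla_X is well
   defined on classes. Write p_v = prod_i 1/(t_i - v_i) for the coefficient of
   phi_v, and g_i = (t_i - v_i) p_v, which does not depend on t_i. Then
     D_(t_i) g_i = beta_(v_i,i) p_v + beta_(1-v_i,i) p_(sigma_i v) + a x_i g_i / (1 - t.x),
   so each a x_i g_i / (1 - t.x) is cohomologous to a constant combination of the p_w.
   Since 1 - t.x = (1 - v.x) - sum_i x_i (t_i - v_i), it follows that
   (1 - v.x) p_v / (1 - t.x) is cohomologous to f_v Phi, and that row v of nabla_X Phi is
     - sum_k (beta_(v_k,k) phi_v + beta_(1-v_k,k) phi_(sigma_k v)) dx_k / x_k
     - a f_v Phi dlog (1 - v.x).
   This is row v of Xi Phi because C f_w^T = e_w^T / Pi beta_w: with the products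
   G_w = prod_(w_i = 0) delta(v_i,v'_i) / beta_(v_i,i), applying f to
   C = sum_w A_w G_w gives sum_w (gamma_w A_w G_w - sum_(w_l = 0) A_w G_(sigma_l w)),
   which telescopes since gamma_w A_w = sum_(w_l = 1) A_(sigma_l w) for w <> 0. *)
From HB Require Import structures.
Require Import Defs.
From mathcomp Require Import all_boot all_order all_algebra.
From mathcomp Require Import fraction complex mpoly ring reals.
From mathcomp Require Import generic_quotient.
From mathcomp Require classical_sets.

Set Implicit Arguments.
Unset Strict Implicit.
Unset Printing Implicit Defensive.

Import GRing.Theory.
Local Open Scope ring_scope.

(** * Partial derivatives of rational functions *)

Section Derivations.
Variables (K : fieldType) (m : nat).
Local Notation F := (ratfun K m).
Implicit Types (j : 'I_(m + m)) (f g : F) (p : {mpoly K[m + m]}).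

Lemma fracP f : exists n d : {mpoly K[m + m]},
  d != 0 /\ f = FracField.tofrac n / FracField.tofrac d.
Proof.
by exists \n_(repr f), \d_(repr f); split; [exact: denom_ratioP | exact: frac_repr].
Qed.

Lemma pderiv_tofrac j p : pderiv j (FracField.tofrac p) = FracField.tofrac p^`M(j).
Proof.
have := pderiv_frac j p (oner_neq0 {mpoly K[m + m]}).
by rewrite tofrac1 divr1 expr1n tofrac1 divr1 -mpolyC1 mderivC mulr0 subr0 mpolyC1 mulr1.
Qed.

(** The quotient rule for a sum, with the derivatives as free variables, so that [field] works on
    plain symbols instead of fractions of polynomials. [mulf_quot] is its counterpart for a
    product. *)
Lemma addf_quot (L : fieldType) (n d n' d' nj dj n'j d'j : L) : d != 0 -> d' != 0 ->
  ((nj * d' + n * d'j + (n'j * d + n' * dj)) * (d * d')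
    - (n * d' + n' * d) * (dj * d' + d * d'j)) / (d * d') ^+ 2
  = (nj * d - n * dj) / d ^+ 2 + (n'j * d' - n' * d'j) / d' ^+ 2.
Proof. by move=> d0 d'0; field; rewrite d0 d'0. Qed.

Lemma mulf_quot (L : fieldType) (n d n' d' nj dj n'j d'j : L) : d != 0 -> d' != 0 ->
  ((nj * n' + n * n'j) * (d * d') - n * n' * (dj * d' + d * d'j)) / (d * d') ^+ 2
  = (nj * d - n * dj) / d ^+ 2 * (n' / d') + n / d * ((n'j * d' - n' * d'j) / d' ^+ 2).
Proof. by move=> d0 d'0; field; rewrite d0 d'0. Qed.

Lemma pderivD j : {morph (pderiv j : F -> F) : f g / f + g}.
Proof.
move=> f g; have [n [d [d0 ->]]] := fracP f; have [n' [d' [d'0 ->]]] := fracP g.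
rewrite addf_div ?tofrac_eq0 // -!tofracM -tofracD !pderiv_frac ?mulf_neq0 //.
rewrite mderivD !mderivM !(tofracXn, tofracB, tofracD, tofracM).
by rewrite addf_quot ?tofrac_eq0.
Qed.

Lemma pderivM j f g : pderiv j (f * g) = pderiv j f * g + f * pderiv j g.
Proof.
have [n [d [d0 ->]]] := fracP f; have [n' [d' [d'0 ->]]] := fracP g.
rewrite mulf_div -!tofracM !pderiv_frac ?mulf_neq0 // !mderivM.
rewrite !(tofracXn, tofracB, tofracD, tofracM).
by rewrite mulf_quot ?tofrac_eq0.
Qed.

#[local] Opaque pderiv.
#[local] Arguments pderiv : simpl never.

Lemma pderiv_is_zmod j : GRing.zmod_morphism (pderiv j : F -> F).
Proof.
have z : pderiv j (0 : F) = 0 by apply: (addIr (pderiv j 0)); rewrite -pderivD !add0r.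
move=> f g; apply: (addIr (pderiv j g)).
by rewrite -pderivD !subrK.
Qed.
HB.instance Definition _ j :=
  GRing.isZmodMorphism.Build F F (pderiv j) (pderiv_is_zmod j).

(** Differentiate [f * f^-1 = 1]. At [f = 0] both sides vanish, by the convention that the inverse
    of 0 is 0. *)
Lemma pderivV j f : pderiv j f^-1 = - pderiv j f / f ^+ 2.
Proof.
have [->|f0] := eqVneq f 0; first by rewrite invr0 raddf0 oppr0 mul0r.
have p1 : pderiv j (1 : F) = 0.
  by rewrite -tofrac1 pderiv_tofrac -mpolyC1 mderivC tofrac0.
have := pderivM j f f^-1; rewrite divff // p1 => /esym/eqP; rewrite addrC addr_eq0.
move=> /eqP E; apply: (mulfI f0).
by rewrite E expr2 invfM mulNr mulrN mulrCA (mulrA f) divff // mul1r.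
Qed.

Lemma comm_der (L : comPzRingType) (g h gi gj hi hj gij gji hij hji : L) :
  gij * h + gj * hi + (gi * hj + g * hij) - (gji * h + gi * hj + (gj * hi + g * hji))
  = (gij - gji) * h + g * (hij - hji).
Proof. by ring. Qed.

(* The commutator of two derivations is a derivation; this one vanishes on polynomials. *)
Lemma pderiv_comm i j f : pderiv i (pderiv j f) = pderiv j (pderiv i f).
Proof.
pose cm g := pderiv i (pderiv j g) - pderiv j (pderiv i g).
have cmM g h : cm (g * h) = cm g * h + g * cm h.
  rewrite /cm !pderivM !pderivD !pderivM.
  exact: comm_der.
have cmT p : cm (FracField.tofrac p) = 0.
  by rewrite /cm !pderiv_tofrac mderiv_comm subrr.
have [n [d [d0 fE]]] := fracP f; apply: subr0_eq; apply/eqP.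
have d'0 : FracField.tofrac d != 0 :> F by rewrite tofrac_eq0.
(* The numerator is [f * d], and the commutator kills both it and [d]; what remains is
   [cm f * d = 0] with [d] nonzero. *)
have := cmT n; rewrite -[FracField.tofrac n](divfK d'0) -fE cmM cmT mulr0 addr0.
by move/eqP; rewrite mulf_eq0 (negPf d'0) orbF.
Qed.

Lemma cst_is_zmod : GRing.zmod_morphism (@cst K m : K -> F).
Proof. by move=> x y; rewrite /cst mpolyCB tofracB. Qed.
HB.instance Definition _ := GRing.isZmodMorphism.Build K F (@cst K m) cst_is_zmod.
Lemma cst_is_monoid : GRing.monoid_morphism (@cst K m : K -> F).
Proof. by split => [|x y]; rewrite /cst ?mpolyC1 ?tofrac1 // mpolyCM tofracM. Qed.
HB.instance Definition _ := GRing.isMonoidMorphism.Build K F (@cst K m) cst_is_monoid.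

Lemma pderiv_cst j k : pderiv j (cst m k) = 0 :> F.
Proof. by rewrite pderiv_tofrac mderivC tofrac0. Qed.

Lemma pderiv_zvar i j : pderiv i (zvar K j) = (i == j)%:R :> F.
Proof.
rewrite pderiv_tofrac mderivX mnm1E eq_sym.
case: eqP => [->|_]; last by rewrite scale0r tofrac0.
have -> : (U_(j) - U_(j) = 0)%MM by apply/mnmP => l; rewrite mnmBE mnm0E subnn.
by rewrite mpolyX0 scale1r tofrac1.
Qed.

End Derivations.

(** * Regular functions *)

Section Regular.
Variables (K : fieldType) (m : nat).
Local Notation F := (ratfun K m).
Implicit Types (j : 'I_(m + m)) (f g h : F) (p : {mpoly K[m + m]}).

Definition polynomial f : Prop := exists p, f = FracField.tofrac p.

Lemma polynomial_cst k : polynomial (cst m k).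
Proof. by exists k%:MP. Qed.

Lemma polynomial_zvar j : polynomial (zvar K j).
Proof. by exists 'X_j. Qed.

Lemma polynomial1 : polynomial 1.
Proof. by exists 1; rewrite tofrac1. Qed.

Lemma polynomialM f g : polynomial f -> polynomial g -> polynomial (f * g).
Proof. by move=> [p ->] [q ->]; exists (p * q); rewrite tofracM. Qed.

Lemma polynomialB f g : polynomial f -> polynomial g -> polynomial (f - g).
Proof. by move=> [p ->] [q ->]; exists (p - q); rewrite tofracB. Qed.

Lemma polynomial_sum (I : finType) (P : pred I) (E : I -> F) :
  (forall i, polynomial (E i)) -> polynomial (\sum_(i | P i) E i).
Proof.
move=> PE; elim/big_ind: _ => // [|f g [p ->] [q ->]]; first by exists 0; rewrite tofrac0.
by exists (p + q); rewrite tofracD.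
Qed.

Lemma polynomial_prod (I : finType) (P : pred I) (E : I -> F) :
  (forall i, polynomial (E i)) -> polynomial (\prod_(i | P i) E i).
Proof. by move=> PE; elim/big_ind: _ => //; [exact: polynomial1 | exact: polynomialM]. Qed.

Lemma polynomial_one_minus_tx : polynomial (one_minus_tx K m).
Proof.
apply: polynomialB; first exact: polynomial1.
by apply: polynomial_sum => i; apply: polynomialM; exact: polynomial_zvar.
Qed.

Lemma polynomial_one_minus_vx (v : Z2 m) : polynomial (one_minus_vx K v).
Proof.
apply: polynomialB; first exact: polynomial1.
apply: polynomial_sum => i; apply: polynomialM; last exact: polynomial_zvar.
by rewrite -(rmorph_nat (@cst K m)); exact: polynomial_cst.
Qed.

Lemma zvar_neq0 j : zvar K j != 0 :> F.
Proof.
rewrite tofrac_eq0; apply/eqP => /(congr1 (mcoeff U_(j))).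
by rewrite mcoeffX eqxx mcoeff0 => /eqP; rewrite oner_eq0.
Qed.

(** Evaluation at the origin: the sum is a polynomial without constant term, hence differs from
    1. *)
Lemma one_minus_neq0 (I : finType) (E : I -> F) :
  (forall i, exists2 p, E i = FracField.tofrac p & p.@[fun=> 0] = 0) ->
  1 - \sum_i E i != 0.
Proof.
move=> PE; suff [p -> p0] : exists2 p, \sum_i E i = FracField.tofrac p & p.@[fun=> 0] = 0.
  rewrite -tofrac1 -tofracB tofrac_eq0; apply/eqP => /(congr1 (meval (fun=> 0))).
  by rewrite mevalB meval1 p0 meval0 subr0 => /eqP; rewrite oner_eq0.
elim/big_ind: _ => [|f g [p -> p0] [q -> q0]|i _]; last exact: PE.
  by exists 0; rewrite ?tofrac0 ?meval0.
by exists (p + q); rewrite ?tofracD // mevalD p0 q0 addr0.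
Qed.

Lemma mevalMX0 p j : (p * 'X_j).@[fun=> 0] = 0.
Proof. by rewrite mevalM mevalXU mulr0. Qed.

Lemma one_minus_tx_neq0 : one_minus_tx K m != 0.
Proof.
apply: one_minus_neq0 => i.
exists ('X_(lshift m i) * 'X_(rshift m i)); first by rewrite tofracM.
exact: mevalMX0.
Qed.

Lemma one_minus_vx_neq0 (v : Z2 m) : one_minus_vx K v != 0.
Proof.
apply: one_minus_neq0 => i.
exists ((v i)%:R%:MP * 'X_(rshift m i)); last exact: mevalMX0.
by rewrite tofracM -/(cst m _) rmorph_nat.
Qed.

Lemma one_minus_t_neq0 (i : 'I_m) : 1 - tvar K i != 0.
Proof.
(* A single variable is a sum indexed by [unit]. *)
have := @one_minus_neq0 unit (fun=> tvar K i); rewrite big_const card_unit /= addr0; apply.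
by move=> _; exists ('X_(lshift m i)); rewrite // -['X_ _]mul1r mevalMX0.
Qed.

Lemma polar_neq0 : polar K m != 0.
Proof.
apply: mulf_neq0; apply: mulf_neq0; first exact: one_minus_tx_neq0.
- apply/prodf_neq0 => i _; apply: mulf_neq0; first exact: zvar_neq0.
  exact: one_minus_t_neq0.
- by apply/prodf_neq0 => i _; exact: zvar_neq0.
- by apply/prodf_neq0 => v _; exact: one_minus_vx_neq0.
Qed.

Lemma polynomial_polar : polynomial (polar K m).
Proof.
apply: polynomialM; apply: polynomialM; try apply: polynomial_prod => i.
- exact: polynomial_one_minus_tx.
- apply: polynomialM; first exact: polynomial_zvar.
  by apply: polynomialB; [exact: polynomial1 | exact: polynomial_zvar].
- exact: polynomial_zvar.
- exact: polynomial_one_minus_vx.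
Qed.

Lemma regular_polynomial f : polynomial f -> regular f.
Proof. by move=> [p ->]; exists p, 0; rewrite expr0 divr1. Qed.

Lemma regularM f g : regular f -> regular g -> regular (f * g).
Proof.
move=> [p [k ->]] [q [l ->]]; exists (p * q), (k + l)%N.
by rewrite tofracM exprD mulf_div.
Qed.

Lemma regularD f g : regular f -> regular g -> regular (f + g).
Proof.
move=> [p [k ->]] [q [l ->]].
have [P PE] := polynomial_polar.
exists (p * P ^+ l + q * P ^+ k), (k + l)%N.
by rewrite tofracD !tofracM !tofracXn -PE exprD addf_div ?expf_neq0 ?polar_neq0.
Qed.

Lemma regularN f : regular f -> regular (- f).
Proof. by move=> [p [k ->]]; exists (- p), k; rewrite tofracN mulNr. Qed.

Lemma regular0 : regular (0 : F).
Proof. by exists 0, 0; rewrite tofrac0 mul0r. Qed.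

Lemma regular_prod (I : finType) (P : pred I) (E : I -> F) :
  (forall i, P i -> regular (E i)) -> regular (\prod_(i | P i) E i).
Proof.
move=> PE; elim/big_ind: _ => //; last exact: regularM.
by apply: regular_polynomial; exact: polynomial1.
Qed.

(** The quotient rule squares the denominator, which stays a power of [polar]; hence the exponent
    [k * 2]. *)
Lemma regular_pderiv j f : regular f -> regular (pderiv j f).
Proof.
move=> [p [k ->]]; have [P PE] := polynomial_polar.
have P0 : P ^+ k != 0.
  by rewrite -(tofrac_eq0 (P ^+ k)) tofracXn -PE expf_neq0 ?polar_neq0.
rewrite PE -tofracXn pderiv_frac //.
exists (p^`M(j) * P ^+ k - p * (P ^+ k)^`M(j)), (k * 2)%N.
by rewrite exprM PE !tofracXn.
Qed.

(** Since 1/f = g/(fg), inverting a product regularly inverts each polynomial factor. This extracts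
    from [polar] the inverses of all the functions that occur in the denominators below. *)
Lemma regularVl f g : polynomial g -> g != 0 -> regular (f * g)^-1 -> regular f^-1.
Proof.
move=> pg g0 r; rewrite -[f^-1](divfK g0) -invfM.
by apply: regularM => //; exact: regular_polynomial.
Qed.

Lemma regularV_prod (I : finType) (E : I -> F) i :
  (forall i, polynomial (E i)) -> (forall i, E i != 0) ->
  regular (\prod_i E i)^-1 -> regular (E i)^-1.
Proof.
move=> pE E0; rewrite (bigD1 i) //=; apply: regularVl; first exact: polynomial_prod.
exact/prodf_neq0.
Qed.

Lemma regularV_factors f1 f2 f3 f4 : f1 != 0 -> f2 != 0 -> f3 != 0 -> f4 != 0 ->
  polynomial f1 -> polynomial f2 -> polynomial f3 -> polynomial f4 ->
  regular (f1 * f2 * (f3 * f4))^-1 ->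
  [/\ regular f1^-1, regular f2^-1, regular f3^-1 & regular f4^-1].
Proof.
move=> n1 n2 n3 n4 p1 p2 p3 p4 r.
have r12 : regular (f1 * f2)^-1.
  exact: (regularVl (polynomialM p3 p4) (mulf_neq0 n3 n4) r).
have r34 : regular (f3 * f4)^-1.
  rewrite mulrC in r.
  exact: (regularVl (polynomialM p1 p2) (mulf_neq0 n1 n2) r).
split; first exact: regularVl p2 n2 r12.
- by rewrite mulrC in r12; exact: regularVl p1 n1 r12.
- exact: regularVl p4 n4 r34.
- by rewrite mulrC in r34; exact: regularVl p3 n3 r34.
Qed.

Lemma polynomial_one_minus_t (i : 'I_m) : polynomial (1 - tvar K i).
Proof. by apply: polynomialB; [exact: polynomial1 | exact: polynomial_zvar]. Qed.

Lemma regularV_polar_factors :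
  [/\ regular (one_minus_tx K m)^-1,
      regular (\prod_(i < m) (tvar K i * (1 - tvar K i)))^-1,
      regular (\prod_(i < m) xvar K i)^-1
    & regular (\prod_(v : Z2 m) one_minus_vx K v)^-1].
Proof.
apply: regularV_factors.
- exact: one_minus_tx_neq0.
- apply/prodf_neq0 => i _; apply: mulf_neq0; first exact: zvar_neq0.
  exact: one_minus_t_neq0.
- by apply/prodf_neq0 => i _; exact: zvar_neq0.
- by apply/prodf_neq0 => v _; exact: one_minus_vx_neq0.
- exact: polynomial_one_minus_tx.
- apply: polynomial_prod => i; apply: polynomialM; first exact: polynomial_zvar.
  exact: polynomial_one_minus_t.
- by apply: polynomial_prod => i; exact: polynomial_zvar.
- by apply: polynomial_prod => v; exact: polynomial_one_minus_vx.
(* The inverse of [polar] is regular by definition, with numerator 1 and exponent 1. *)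
- by exists 1, 1; rewrite tofrac1 mul1r expr1.
Qed.

Lemma regular_one_minus_txV : regular (one_minus_tx K m)^-1.
Proof. by case: regularV_polar_factors. Qed.

Lemma regular_t_one_minus_tV (i : 'I_m) :
  regular (tvar K i)^-1 /\ regular (1 - tvar K i)^-1.
Proof.
have [_ r _ _] := regularV_polar_factors.
have {}r : regular (tvar K i * (1 - tvar K i))^-1.
  apply: (@regularV_prod _ (fun i => tvar K i * (1 - tvar K i))) r => l.
    by apply: polynomialM; [exact: polynomial_zvar | exact: polynomial_one_minus_t].
  by apply: mulf_neq0; [exact: zvar_neq0 | exact: one_minus_t_neq0].
split.
  by apply: regularVl r; [exact: polynomial_one_minus_t | exact: one_minus_t_neq0].
move: r; rewrite mulrC => r.
by apply: regularVl r; [exact: polynomial_zvar | exact: zvar_neq0].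
Qed.

Lemma regular_xV (i : 'I_m) : regular (xvar K i)^-1.
Proof.
have [_ _ r _] := regularV_polar_factors.
apply: (@regularV_prod _ (fun i => xvar K i)) r => l; first exact: polynomial_zvar.
exact: zvar_neq0.
Qed.

Lemma regular_one_minus_vxV (v : Z2 m) : regular (one_minus_vx K v)^-1.
Proof.
have [_ _ _ r] := regularV_polar_factors.
apply: (@regularV_prod _ (fun v => one_minus_vx K v)) r => l.
  exact: polynomial_one_minus_vx.
exact: one_minus_vx_neq0.
Qed.

End Regular.

(** * Exterior products *)

Section Wedge.
Variables (K : fieldType) (m : nat).
Local Notation F := (ratfun K m).
Local Notation form := (Defs.form K m).
Implicit Types (i j : 'I_(m + m)) (u w : form) (g : F) (L J : {set 'I_(m + m)}).

Lemma wedgeDl w : {morph (fun u => wedge u w) : u1 u2 / u1 + u2}.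
Proof.
move=> u1 u2; apply/ffunP => L; rewrite !ffunE -big_split /=.
by apply: eq_bigr => I _; rewrite !ffunE mulrDl mulrDr.
Qed.

Lemma wedge0l w : wedge 0 w = 0.
Proof. by apply: (addIr (wedge 0 w)); rewrite -wedgeDl !add0r. Qed.

Lemma wedgeZl g u w : wedge (g *: u) w = g *: wedge u w.
Proof.
apply/ffunP => L; rewrite !ffunE scaler_sumr.
apply: eq_bigr => I _; rewrite !ffunE /GRing.scale /=.
by rewrite -mulrA mulrCA.
Qed.

Lemma wedge_suml (I : finType) (P : pred I) (U : I -> form) w :
  wedge (\sum_(i | P i) U i) w = \sum_(i | P i) wedge (U i) w.
Proof. exact: (big_morph _ (wedgeDl w) (wedge0l w)). Qed.

Lemma dzsetE I J : dzset K I J = (J == I)%:R.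
Proof. by rewrite ffunE. Qed.

#[local] Opaque dzset.
#[local] Arguments dzset : simpl never.

(** Every product below has a 1-form as left factor, so it is a combination of these operators,
    whose coefficients [dzwedgeE] gives without a sum. *)
Definition dzwedge j (w : form) : form := wedge (dzset K [set j]) w.

Lemma dzwedgeE j w L : dzwedge j w L =
  if j \in L then (-1) ^+ inversions [set j] (L :\ j) * w (L :\ j) else 0.
Proof.
rewrite ffunE; case: ifPn => jL.
  rewrite (bigD1 [set j]) /=; last by rewrite sub1set.
  rewrite dzsetE eqxx mul1r big1 ?addr0 // => I.
  by case/andP=> _ /negPf Ij; rewrite dzsetE Ij mul0r mulr0.
rewrite big1 // => I IL; rewrite dzsetE; case: eqP => [IE|_]; last by rewrite mul0r mulr0.
by move: IL; rewrite IE sub1set (negPf jL).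
Qed.

Lemma dzwedge_is_zmod j : GRing.zmod_morphism (dzwedge j).
Proof.
move=> u w; apply/ffunP => L.
have fB (x y : form) : (x - y) L = x L - y L by rewrite !ffunE.
rewrite fB !dzwedgeE; case: ifP => _; last by rewrite subr0.
by rewrite !ffunE mulrBr.
Qed.
HB.instance Definition _ j :=
  GRing.isZmodMorphism.Build form form (dzwedge j) (dzwedge_is_zmod j).

Lemma dzwedgeZ j g w : dzwedge j (g *: w) = g *: dzwedge j w.
Proof.
apply/ffunP => L.
have fZ (x : form) : (g *: x) L = g * x L by rewrite !ffunE.
rewrite fZ !dzwedgeE; case: ifP => _; last by rewrite mulr0.
by rewrite !ffunE mulrCA.
Qed.

Lemma inversions1l j J : inversions [set j] J = #|[set l in J | (l < j)%N]|.
Proof.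
have pj : injective (fun x : 'I_(m + m) => (j, x)) by move=> x y [].
rewrite /inversions -(card_imset _ pj); apply: eq_card => -[x y].
rewrite !inE /=; apply/idP/imsetP => [/and3P[/eqP -> yJ yj]|[z + [-> ->]]].
  by exists y; rewrite // inE yJ.
by rewrite inE eqxx.
Qed.

(** Dropping [j] loses an inversion exactly when [j < i]. This is the sign comparison behind
    anticommutation. *)
Lemma inversions1l_D1 i j J : i != j -> j \in J ->
  inversions [set i] J = (inversions [set i] (J :\ j) + (j < i))%N.
Proof.
move=> ij jJ; rewrite !inversions1l (cardsD1 j) inE jJ addnC; congr (_ + _)%N.
by apply: eq_card => l; rewrite !inE andbA.
Qed.

Lemma dzwedge_anticomm i j w : dzwedge i (dzwedge j w) = - dzwedge j (dzwedge i w).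
Proof.
apply/ffunP => L; rewrite [RHS]ffunE !dzwedgeE !inE.
have [<-|ij] := eqVneq i j; first by rewrite /= mulr0 if_same oppr0.
rewrite /=; case: (boolP (i \in L)) => iL; case: (boolP (j \in L)) => jL;
  rewrite ?mulr0 ?oppr0 //=.
rewrite !mulrA -!exprD.
have E : L :\ i :\ j = L :\ j :\ i by apply/setP => l; rewrite !inE andbCA.
rewrite E -mulNr; congr (_ * _).
have ji : j != i by rewrite eq_sym.
rewrite (@inversions1l_D1 i j (L :\ i)) ?(@inversions1l_D1 j i (L :\ j)) ?inE ?ij ?ji //.
rewrite E !exprD.
(* The two exponents now differ by [j < i] on one side and [i < j] on the other; exactly one of
   these holds, whence the opposite signs. *)
have [ij'|ji'|/val_inj/eqP] := ltngtP i j; last by rewrite (negPf ij).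
  by rewrite expr0 expr1 mulr1 mulrN1 mulNr opprK mulrC.
by rewrite expr0 expr1 mulr1 mulrN1 mulNr mulrC.
Qed.

Lemma pderiv_dzset j I J : pderiv j (dzset K I J : F) = 0.
Proof. by rewrite dzsetE -(rmorph_nat (@cst K m)) pderiv_cst. Qed.

End Wedge.

(** * The form dT, bidegrees, and contractions of dT *)

Section TopForm.
Variables (K : fieldType) (m : nat).
Local Notation F := (ratfun K m).
Local Notation form := (Defs.form K m).

Definition lshift_set (s : seq 'I_m) : {set 'I_(m + m)} := [set lshift m i | i in s].

Lemma dzwedge_dzset (j : 'I_(m + m)) (J : {set 'I_(m + m)}) : j \notin J ->
  dzwedge j (dzset K J) = (-1) ^+ inversions [set j] J *: dzset K (j |: J).
Proof.
move=> jJ; apply/ffunP => L.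
have fZ (g : F) (x : form) : (g *: x) L = g * x L by rewrite !ffunE.
rewrite fZ dzwedgeE !dzsetE; case: (eqVneq L (j |: J)) => [->|LJ].
  by rewrite setU11 setU1K // eqxx.
rewrite mulr0; case: ifP => // jL; case: eqP => [LE|_]; last by rewrite mulr0.
by move: LJ; rewrite -LE setD1K // eqxx.
Qed.

(** Each new factor contributes the sign of its insertion. The exponent is existential because later
    arguments only use that the coefficient is a sign, hence a constant. *)
Lemma dt_product (s : seq 'I_m) : uniq s -> exists n : nat,
  \big[@wedge K m/fun_form 1]_(i <- s) dt K i = (-1) ^+ n *: dzset K (lshift_set s).
Proof.
elim: s => [|i s IH] /=.
  move=> _; exists 0; rewrite big_nil expr0 /fun_form; congr (_ *: dzset _ _).
  by apply/setP => l; rewrite inE; apply/esym/imsetP => -[].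
case/andP=> iNs us; have [n nE] := IH us.
rewrite big_cons nE -/(dzwedge _ _) dzwedgeZ dzwedge_dzset.
  rewrite scalerA -exprD; eexists; congr (_ *: dzset _ _).
  apply/setP => l; rewrite !inE; apply/idP/imsetP.
    move=> /orP[/eqP ->|/imsetP[k ks ->]]; first by exists i; rewrite // inE eqxx.
    by exists k; rewrite // inE ks orbT.
  move=> [k + ->]; rewrite inE => /orP[/eqP ->|ks]; first by rewrite eqxx.
  by rewrite [X in _ || X](imset_f _ ks) orbT.
by apply/imsetP => -[k ks /lshift_inj ik]; rewrite ik ks in iNs.
Qed.

Definition tset : {set 'I_(m + m)} := [set lshift m i | i : 'I_m].

Lemma dT_dzset : exists n : nat, dT K m = (-1) ^+ n *: dzset K tset.
Proof.
have [n nE] := dt_product (index_enum_uniq 'I_m); exists n; rewrite /dT nE.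
congr (_ *: dzset _ _); apply/setP => l.
by apply/imsetP/imsetP => -[k _ ->]; exists k; rewrite // ?inE ?mem_index_enum.
Qed.

Lemma tdeg_tset : tdeg tset = m.
Proof.
rewrite /tdeg -[RHS]card_ord; apply: eq_card => i.
by rewrite !inE; apply/imsetP; exists i.
Qed.

Lemma xdeg_tset : xdeg tset = 0.
Proof.
apply/eqP; rewrite cards_eq0; apply/eqP/setP => i; rewrite !inE.
by apply/imsetP => -[k _ /eqP]; rewrite eq_rlshift.
Qed.

Lemma lshift_tset i : lshift m i \in tset.
Proof. by apply/imsetP; exists i. Qed.

Lemma tdeg_D1 (J : {set 'I_(m + m)}) i : lshift m i \in J ->
  tdeg J = (tdeg (J :\ lshift m i)).+1 /\ xdeg (J :\ lshift m i) = xdeg J.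
Proof.
move=> iJ; split.
  rewrite /tdeg (cardsD1 i) inE iJ; congr _.+1; apply: eq_card => l.
  by rewrite !inE (inj_eq (@lshift_inj _ _)).
by apply: eq_card => l; rewrite !inE eq_rlshift.
Qed.

Lemma xdeg_D1 (J : {set 'I_(m + m)}) i : rshift m i \in J ->
  tdeg (J :\ rshift m i) = tdeg J /\ xdeg J = (xdeg (J :\ rshift m i)).+1.
Proof.
move=> iJ; split.
  by apply: eq_card => l; rewrite !inE eq_lrshift.
rewrite /xdeg (cardsD1 i) inE iJ; congr _.+1; apply: eq_card => l.
by rewrite !inE (inj_eq (@rshift_inj _ _)).
Qed.

(** Up to sign, [eta] is the product of all the dt_l except dt_i. It serves to build primitives: its
    coefficients are constant and dt_j /\ eta vanishes for j different from i, so only the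
    derivative along t_i survives in [nablaT (g *: eta)]. *)
Lemma dT_contraction i : exists eta : form,
  [/\ forall (J : {set 'I_(m + m)}) j, pderiv j (eta J : F) = 0, Omega m.-1 0 eta
    & forall j, dzwedge (lshift m j) eta = (i == j)%:R *: dT K m].
Proof.
have [n nE] := dT_dzset; pose J := tset :\ lshift m i.
have JE : lshift m i |: J = tset by rewrite setD1K // lshift_tset.
have iJ : lshift m i \notin J by rewrite setD11.
(* The sign of [dT] together with the sign of inserting dt_i; multiplying by dt_i repeats the
   latter, and the two cancel. *)
pose N := (n + inversions [set lshift m i] J)%N.
pose eta : form := (-1) ^+ N *: dzset K J.
have etaE I : eta I = cst m ((-1) ^+ N * (I == J)%:R).
  by rewrite rmorphM rmorph_sign rmorph_nat ffunE dzsetE.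
exists eta; split=> [I j|I|j].
- by rewrite etaE pderiv_cst.
- rewrite etaE; split; first exact: regular_polynomial (polynomial_cst _ _).
  case: (eqVneq I J) => [->|_]; last by rewrite mulr0 rmorph0 eqxx.
  move=> _; have [] := tdeg_D1 (lshift_tset i); rewrite -/J tdeg_tset xdeg_tset.
  by move=> /(congr1 predn) E ->; split; first exact/esym/E.
- rewrite dzwedgeZ; case: eqVneq => [<-|ij].
    rewrite (dzwedge_dzset iJ) JE scalerA -exprD nE scale1r.
    rewrite /N -addnA exprD (addnn (inversions _ J)).
    by rewrite -[X in _ * X]signr_odd odd_double expr0 mulr1.
  rewrite scale0r -[RHS](scaler0 _ ((-1) ^+ N)); congr (_ *: _).
  apply/ffunP => L; rewrite dzwedgeE dzsetE [RHS]ffunE; case: ifP => // jL.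
  case: eqP => [LJ|_]; last by rewrite mulr0.
  (* For j different from i, the factor dt_j already occurs in [eta], so the product is zero. *)
  have : lshift m j \in J by rewrite !inE (inj_eq (@lshift_inj _ _)) eq_sym ij lshift_tset.
  by rewrite -LJ !inE eqxx.
Qed.

End TopForm.

#[local] Arguments dzwedge : simpl never.
#[local] Arguments beta : simpl never.
#[local] Arguments dzset : simpl never.
#[local] Opaque dzset.

(** * The connections and their cohomology *)

Section Derivatives.
Variables (K : fieldType) (m : nat).
Local Notation F := (ratfun K m).
Implicit Types (j : 'I_(m + m)) (i k : 'I_m).

Lemma pderiv_t_t i k : pderiv (lshift m i) (tvar K k) = (i == k)%:R :> F.
Proof. by rewrite pderiv_zvar (inj_eq (@lshift_inj _ _)). Qed.

Lemma pderiv_x_t i k : pderiv (rshift m i) (tvar K k) = 0 :> F.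
Proof. by rewrite pderiv_zvar eq_rlshift. Qed.

Lemma pderiv_t_x i k : pderiv (lshift m i) (xvar K k) = 0 :> F.
Proof. by rewrite pderiv_zvar eq_lrshift. Qed.

Lemma pderiv_x_x i k : pderiv (rshift m i) (xvar K k) = (i == k)%:R :> F.
Proof. by rewrite pderiv_zvar (inj_eq (@rshift_inj _ _)). Qed.

Lemma pderiv_nat j n : pderiv j (n%:R : F) = 0.
Proof. by rewrite -(rmorph_nat (@cst K m)) pderiv_cst. Qed.

Lemma pderiv_t_one_minus_tx i : pderiv (lshift m i) (one_minus_tx K m) = - xvar K i.
Proof.
rewrite /one_minus_tx raddfB /= (pderiv_nat _ 1) sub0r raddf_sum; congr (- _).
rewrite (bigD1 i) //= pderivM pderiv_t_t pderiv_t_x eqxx mul1r mulr0 addr0.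
rewrite big1 ?addr0 // => k ki.
by rewrite pderivM pderiv_t_t pderiv_t_x eq_sym (negPf ki) mul0r mulr0 addr0.
Qed.

Lemma pderiv_x_one_minus_tx i : pderiv (rshift m i) (one_minus_tx K m) = - tvar K i.
Proof.
rewrite /one_minus_tx raddfB /= (pderiv_nat _ 1) sub0r raddf_sum; congr (- _).
rewrite (bigD1 i) //= pderivM pderiv_x_t pderiv_x_x eqxx mulr1 mul0r add0r.
rewrite big1 ?addr0 // => k ki.
by rewrite pderivM pderiv_x_t pderiv_x_x eq_sym (negPf ki) mul0r mulr0 addr0.
Qed.

Lemma pderiv_t_one_minus_vx i (v : Z2 m) : pderiv (lshift m i) (one_minus_vx K v) = 0.
Proof.
rewrite /one_minus_vx raddfB /= (pderiv_nat _ 1) sub0r raddf_sum /= big1 ?oppr0 //.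
by move=> k _; rewrite pderivM pderiv_t_x pderiv_nat mul0r mulr0 addr0.
Qed.

Lemma pderiv_x_one_minus_vx i (v : Z2 m) :
  pderiv (rshift m i) (one_minus_vx K v) = - (v i)%:R.
Proof.
rewrite /one_minus_vx raddfB /= (pderiv_nat _ 1) sub0r raddf_sum; congr (- _).
rewrite (bigD1 i) //= pderivM pderiv_nat pderiv_x_x eqxx mulr1 mul0r add0r.
rewrite big1 ?addr0 // => k ki.
by rewrite pderivM pderiv_nat pderiv_x_x eq_sym (negPf ki) mul0r mulr0 addr0.
Qed.

Lemma one_minus_vx_sub_tx (v : Z2 m) :
  one_minus_vx K v - one_minus_tx K m = \sum_i xvar K i * (tvar K i - (v i)%:R).
Proof.
rewrite /one_minus_vx /one_minus_tx opprB addrC addrA subrK -sumrB.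
by apply: eq_bigr => i _; rewrite mulrBr mulrC [_ * xvar K i]mulrC.
Qed.

End Derivatives.

#[local] Opaque tvar xvar one_minus_tx one_minus_vx.

(** * The operators D_j and the anticommutation of the two connections *)

Section Connection.
Variables (K : fieldType) (m : nat) (a : K) (b c : 'I_m -> K).
Local Notation F := (ratfun K m).
Local Notation form := (Defs.form K m).
Implicit Types (j : 'I_(m + m)) (i k : 'I_m) (u w : form) (f g : F).

(** One family for the coefficients of both [omegaT] and [omegaX], indexed by all the variables, so
    that both connections are sums of [dzwedge j] after [nab_form j]. *)
Definition omega j : F :=
  match split j with
  | inl i => cst m (beta b c false i) / tvar K i + cst m (beta b c true i) / (tvar K i - 1)
             + cst m a * xvar K i / one_minus_tx K m
  | inr i => cst m a * tvar K i / one_minus_tx K m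
  end.

Definition nab j g : F := pderiv j g + omega j * g.

Definition nab_form j w : form := [ffun I : {set 'I_(m + m)} => nab j (w I)].

Lemma omega_t i : omega (lshift m i) =
  cst m (beta b c false i) / tvar K i + cst m (beta b c true i) / (tvar K i - 1)
  + cst m a * xvar K i / one_minus_tx K m.
Proof. by rewrite /omega (unsplitK (inl i)). Qed.

Lemma omega_x i : omega (rshift m i) = cst m a * tvar K i / one_minus_tx K m.
Proof. by rewrite /omega (unsplitK (inr i)). Qed.

#[local] Opaque omega.

Lemma nabE j w : nab_form j w = pderiv_form j w + omega j *: w.
Proof. by apply/ffunP => I; rewrite !ffunE. Qed.

Lemma nablaTE w :
  nablaT a b c w = \sum_i dzwedge (lshift m i) (nab_form (lshift m i) w).
Proof.
rewrite /nablaT /extT /omegaT wedge_suml -big_split; apply: eq_bigr => i _ /=.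
by rewrite nabE (raddfD (dzwedge _)) /= dzwedgeZ wedgeZl omega_t.
Qed.

Lemma nablaXE w :
  nablaX a w = \sum_i dzwedge (rshift m i) (nab_form (rshift m i) w).
Proof.
rewrite /nablaX /extX /omegaX wedge_suml -big_split; apply: eq_bigr => i _ /=.
by rewrite nabE (raddfD (dzwedge _)) /= dzwedgeZ wedgeZl omega_x.
Qed.

Lemma nab_is_zmod j : GRing.zmod_morphism (nab j).
Proof. by move=> f g; rewrite /nab raddfB mulrBr addrACA opprD. Qed.
HB.instance Definition _ j := GRing.isZmodMorphism.Build F F (nab j) (nab_is_zmod j).

Lemma nab_form_is_zmod j : GRing.zmod_morphism (nab_form j).
Proof. by move=> u w; apply/ffunP => I; rewrite !ffunE raddfB. Qed.
HB.instance Definition _ j :=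
  GRing.isZmodMorphism.Build form form (nab_form j) (nab_form_is_zmod j).

Lemma nablaT_is_zmod : GRing.zmod_morphism (nablaT a b c : form -> form).
Proof.
move=> u w; rewrite !nablaTE -sumrB; apply: eq_bigr => i _.
by rewrite !raddfB.
Qed.
HB.instance Definition _ :=
  GRing.isZmodMorphism.Build form form (nablaT a b c) nablaT_is_zmod.

Lemma nablaXB u w : nablaX a (u - w) = nablaX a u - nablaX a w.
Proof.
rewrite !nablaXE -sumrB; apply: eq_bigr => i _.
by rewrite !raddfB.
Qed.

(** Both coefficients are partial derivatives of -a log(1 - t.x), up to the terms in beta, which
    depend on t_i alone and are killed by the derivative in x_k. *)
Lemma omega_closed i k :
  pderiv (lshift m i) (omega (rshift m k)) = pderiv (rshift m k) (omega (lshift m i)).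
Proof.
have E : pderiv (rshift m k) (tvar K i - 1) = 0.
  by rewrite (raddfB (pderiv _)) /= pderiv_x_t (pderiv_nat _ _ 1) subrr.
rewrite omega_t omega_x; move: (tvar K i - 1) E => y E.
rewrite !pderivD !pderivM !pderivV !pderiv_cst E pderiv_t_one_minus_tx pderiv_x_one_minus_tx.
rewrite pderiv_t_t !pderiv_x_t pderiv_x_x eq_sym.
rewrite !(mul0r, mulr0, add0r, subrr, oppr0, opprK) -!mulrA; congr (_ + _ * _).
exact: mulrCA.
Qed.

Lemma nab_comm_eq (L : comPzRingType) (gij gi gj g wi wj wij : L) :
  gij + (wij * g + wj * gi) + wi * (gj + wj * g)
  = gij + (wij * g + wi * gj) + wj * (gi + wi * g).
Proof. by ring. Qed.

Lemma nab_comm i k g : nab (lshift m i) (nab (rshift m k) g)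
  = nab (rshift m k) (nab (lshift m i) g).
Proof.
rewrite /nab !pderivD !(pderivM _ (omega _)) (pderiv_comm (lshift m i)) -omega_closed.
exact: nab_comm_eq.
Qed.

(** [dzwedge j] only moves coefficients and changes their signs, and [nab i] acts on each
    coefficient additively. *)
Lemma nab_dzwedge (i : 'I_(m + m)) j w :
  nab_form i (dzwedge j w) = dzwedge j (nab_form i w).
Proof.
apply/ffunP => I; rewrite [LHS]ffunE !dzwedgeE; case: ifP => _; last by rewrite raddf0.
rewrite [nab_form _ _ _]ffunE -signr_odd.
by case: odd; rewrite ?expr0 ?mul1r // expr1 !mulN1r raddfN.
Qed.

Lemma nablaT_nablaX w : nablaT a b c (nablaX a w) = - nablaX a (nablaT a b c w).
Proof.
rewrite nablaXE nablaTE [nablaX _ _]nablaXE nablaTE -sumrN.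
under eq_bigr do rewrite !raddf_sum.
rewrite exchange_big; apply: eq_bigr => k _ /=.
rewrite !raddf_sum; apply: eq_bigr => i _ /=.
rewrite !nab_dzwedge dzwedge_anticomm; congr (- dzwedge _ (dzwedge _ _)).
by apply/ffunP => I; rewrite !ffunE nab_comm.
Qed.

End Connection.

#[local] Opaque omega.

(** * Regularity, bidegrees and exact forms *)

Section Cohomology.
Variables (K : fieldType) (m : nat) (a : K) (b c : 'I_m -> K).
Local Notation F := (ratfun K m).
Local Notation form := (Defs.form K m).
Implicit Types (j : 'I_(m + m)) (i k : 'I_m) (u w : form) (f g : F) (p q : nat).

Lemma regular_cst (k : K) : regular (cst m k).
Proof. exact: regular_polynomial (polynomial_cst _ _). Qed.

Lemma regular_t i : regular (tvar K i).
Proof. exact: regular_polynomial (polynomial_zvar _ _). Qed.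

Lemma regular_x i : regular (xvar K i).
Proof. exact: regular_polynomial (polynomial_zvar _ _). Qed.

Lemma regular_t1V i : regular (tvar K i - 1)^-1.
Proof.
rewrite -opprB invrN; apply: regularN.
by have [] := regular_t_one_minus_tV K i.
Qed.

Lemma regular_omega j : regular (omega a b c j).
Proof.
rewrite -[j]splitK; case: (split j) => i /=; rewrite ?omega_t ?omega_x; last first.
  apply: regularM (regular_one_minus_txV _ _).
  exact: regularM (regular_cst _) (regular_t _).
apply: regularD; first apply: regularD.
- by apply: regularM (regular_cst _) _; have [] := regular_t_one_minus_tV K i.
- exact: regularM (regular_cst _) (regular_t1V _).
- apply: regularM (regular_one_minus_txV _ _).
  exact: regularM (regular_cst _) (regular_x _).
Qed.

Lemma regular_nab j g : regular g -> regular (nab a b c j g).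
Proof.
move=> rg; apply: regularD; first exact: regular_pderiv.
exact: regularM (regular_omega _) rg.
Qed.

Lemma Omega0 p q : Omega p q (0 : form).
Proof. by move=> I; rewrite ffunE; split; [exact: regular0 | rewrite eqxx]. Qed.

Lemma OmegaD p q u w : Omega p q u -> Omega p q w -> Omega p q (u + w).
Proof.
move=> hu hw I; have [ru du] := hu I; have [rw dw] := hw I; rewrite ffunE; split.
  exact: regularD.
have [->|u0 _] := eqVneq (u I) 0; last exact: du.
by rewrite add0r => /dw.
Qed.

Lemma OmegaZ p q g w : regular g -> Omega p q w -> Omega p q (g *: w).
Proof.
move=> rg hw I; have [rw dw] := hw I; rewrite ffunE; split; first exact: regularM.
have [->|w0 _] := eqVneq (w I) 0; last exact: dw.
by rewrite scaler0 eqxx.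
Qed.

Lemma OmegaN p q w : Omega p q w -> Omega p q (- w).
Proof.
rewrite -scaleN1r; apply: OmegaZ; apply: regularN.
exact: regular_polynomial (polynomial1 _ _).
Qed.

Lemma Omega_sum (I : finType) p q (W : I -> form) :
  (forall l, Omega p q (W l)) -> Omega p q (\sum_l W l).
Proof.
move=> hW; apply: (big_ind (Omega p q)) => [|u w|l _].
- exact: Omega0.
- exact: OmegaD.
- exact: hW.
Qed.

Lemma Omega_nab_form p q j w : Omega p q w -> Omega p q (nab_form a b c j w).
Proof.
move=> hw I; have [rw dw] := hw I; rewrite ffunE; split; first exact: regular_nab.
have [->|w0 _] := eqVneq (w I) 0; last exact: dw.
by rewrite raddf0 eqxx.
Qed.

Lemma Omega_dzwedge_x p q k w : Omega p q w -> Omega p q.+1 (dzwedge (rshift m k) w).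
Proof.
move=> hw I; rewrite dzwedgeE; case: ifP => [kI|_]; last first.
  by split; [exact: regular0 | rewrite eqxx].
have [rw dw] := hw (I :\ rshift m k); split.
  by apply: regularM rw; rewrite -(rmorph_sign (@cst K m)); exact: regular_cst.
have [->|w0 _] := eqVneq (w (I :\ rshift m k)) 0; first by rewrite mulr0 eqxx.
by have [<- <-] := dw w0; have [<- <-] := xdeg_D1 kI.
Qed.

Lemma Omega_nablaX p q w : Omega p q w -> Omega p q.+1 (nablaX a w).
Proof.
move=> hw; rewrite (nablaXE a b c); apply: Omega_sum => k.
by apply: Omega_dzwedge_x; exact: Omega_nab_form.
Qed.

Lemma exactTD q u w : exactT a b c q u -> exactT a b c q w -> exactT a b c q (u + w).
Proof.
move=> [u' hu <-] [w' hw <-]; exists (u' + w'); first exact: OmegaD.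
by rewrite raddfD.
Qed.

Lemma exactTN q w : exactT a b c q w -> exactT a b c q (- w).
Proof. by move=> [w' hw <-]; exists (- w'); [exact: OmegaN | rewrite raddfN]. Qed.

(** By anticommutation, minus [nablaX] of a primitive is a primitive. This is what makes [nablaX]
    pass to the quotients. *)
Lemma exactT_nablaX w : exactT a b c 0 w -> exactT a b c 1 (nablaX a w).
Proof.
move=> [eta heta <-]; exists (- nablaX a eta); first exact: OmegaN (Omega_nablaX heta).
by rewrite raddfN /= nablaT_nablaX opprK.
Qed.

(** Reduces an equality of cosets to the exactness of a single form, computed on one
    representative. *)
Lemma nablaXH_class w w' : exactT a b c 1 (nablaX a w - w') ->
  nablaXH a b c (class a b c 0 w) = class a b c 1 w'.
Proof.
move=> ew; apply/classical_sets.seteqP; split => u /=.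
  (* Write [u - w'] as [(u - nablaX w1) + nablaX (w1 - w) + (nablaX w - w')], a sum of three exact
     forms. *)
  move=> [w1 ew1 eu]; rewrite /class /= -[u](subrK (nablaX a w1)) -addrA.
  apply: (exactTD eu); rewrite -[nablaX a w1](subrK (nablaX a w)) -addrA.
  by apply: exactTD ew; rewrite -(nablaXB a b c); exact: exactT_nablaX.
move=> eu; exists w.
  by rewrite /class /= subrr; exists 0; [exact: Omega0 | rewrite raddf0].
by rewrite -[u](subrK w') -addrA -[w' - _]opprB; exact: (exactTD eu (exactTN ew)).
Qed.

End Cohomology.

(** * The matrix C *)

Section Vertices.
Variable m : nat.
Implicit Types (u v w y : Z2 m) (l : 'I_m).

Lemma flipK l : involutive (flip l : Z2 m -> Z2 m).
Proof. by move=> v; apply/ffunP => i; rewrite !ffunE; case: eqP; rewrite ?negbK. Qed.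

Lemma flip_at l v : flip l v l = ~~ v l.
Proof. by rewrite ffunE eqxx. Qed.

Lemma flip_off l v i : i != l -> flip l v i = v i.
Proof. by rewrite ffunE => /negPf ->. Qed.

Lemma wt_flip l w : w l -> wt w = (wt (flip l w)).+1.
Proof.
move=> wl; rewrite /wt (bigD1 l) //= [in RHS](bigD1 l) //= flip_at wl add0n add1n.
by congr _.+1; apply: eq_bigr => i il; rewrite flip_off.
Qed.

Lemma wt_card v : wt v = #|[set i | v i]|.
Proof.
rewrite -sum1_card /wt (big_mkcond (fun i => _ \in _)); apply: eq_bigr => i _.
by rewrite inE; case: (v i).
Qed.

Lemma eq_of_wt y w : (forall i, y i ==> w i) -> wt y = wt w -> y = w.
Proof.
move=> yw; rewrite !wt_card => yw'; have : [set i | y i] = [set i | w i].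
  apply/eqP; rewrite eqEcard yw' leqnn andbT; apply/subsetP => i; rewrite !inE.
  exact/implyP.
by move=> /setP E; apply/ffunP => i; have := E i; rewrite !inE.
Qed.

(** When the weights differ by one, the supports are nested and differ in one coordinate, so [y] is
    [w] with one of its ones cleared. *)
Lemma psuccP w y : wt w = (wt y).+1 ->
  reflect (exists2 l, w l & y = flip l w) (psucc w y).
Proof.
move=> wyE; apply: (iffP andP) => [[wy /forallP yw]|[l wl ->]]; last first.
  split; first by apply/eqP => /ffunP/(_ l); rewrite flip_at wl.
  apply/forallP => i; rewrite ffunE; case: eqP => [->|_]; first by rewrite wl.
  exact/implyP.
have [l /andP[wl yl]|none] := pickP (fun l => w l && ~~ y l); last first.
  case/eqP: wy; apply/ffunP => i; have := yw i; have := none i.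
  by case: (w i); case: (y i).
exists l => //; apply: eq_of_wt => [i|].
  have := yw i; rewrite ffunE; case: eqP => // -> _.
  by rewrite (negPf yl).
by apply/succn_inj; rewrite -wyE -wt_flip.
Qed.

(** The coordinate [l] is unique when it exists. This converts the order condition on the last step
    of a chain into a sum over the ones of [w]. *)
Lemma sum_psucc (V : nmodType) w y (x : V) : wt w = (wt y).+1 ->
  \sum_(l | w l && (y == flip l w)) x = if psucc w y then x else 0.
Proof.
move=> wy; case: (psuccP wy) => [[l wl yE]|none].
  rewrite (big_pred1 l) // => k; apply/andP/eqP => [[wk /eqP E]|->]; last by rewrite wl yE.
  apply/eqP; apply: contraT => kl; move: E; rewrite yE => /ffunP/(_ k).
  by rewrite flip_at flip_off // wk.
rewrite big_pred0 // => l; apply/negbTE/negP => /andP[wl /eqP yE].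
by apply: none; exists l.
Qed.

Lemma sum_vtx (V : nmodType) (f : Z2 m -> V) : \sum_j f (vtx j) = \sum_v f v.
Proof.
set s := sort (@lev m) (enum {: Z2 m}).
have sz : size s = (2 ^ m)%N.
  by rewrite size_sort -cardE card_ffun card_bool card_ord.
transitivity (\sum_(v <- s) f v); last first.
  by rewrite (perm_big (enum {: Z2 m})) ?perm_sort //= big_enum.
by rewrite (big_nth (zvec m)) sz big_mkord.
Qed.

Lemma vtx_inj : injective (@vtx m).
Proof.
move=> i j; set s := sort (@lev m) (enum {: Z2 m}).
have sz : size s = (2 ^ m)%N.
  by rewrite size_sort -cardE card_ffun card_bool card_ord.
have us : uniq s by rewrite sort_uniq enum_uniq.
by move/eqP; rewrite /vtx nth_uniq ?sz // => /eqP/val_inj.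
Qed.

End Vertices.

(** * Sums over chains and the recursion for A_w *)

Section Chains.
Variables (K : fieldType) (m : nat) (a : K) (c : 'I_m -> K).
Implicit Types (w y : Z2 m) (n : nat).

(* The conditions of is_chain on (w^(1), ..., w^(n)), except that on its last term; the
   length is an arbitrary n instead of wt w, which allows the induction on n. *)
Definition flag n (s : seq (Z2 m)) : bool :=
  path (fun u v => psucc v u) (zvec m) s && [forall j : 'I_n, wt (nth (zvec m) s j) == j.+1].

Definition flag_sum n w : K :=
  \sum_(s : n.-tuple (Z2 m) | flag n s && (last (zvec m) s == w))
     (\prod_(u <- s) gamma a c u)^-1.

Lemma AcoefE w : Acoef a c w = flag_sum (wt w) w.
Proof.
apply: eq_bigl => s; rewrite /is_chain /flag -andbA; congr (_ && _); rewrite andbC.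
by congr (_ && _); apply: eq_forallb => j; rewrite (tnth_nth (zvec m)).
Qed.

Lemma wt_last_flag n (s : n.-tuple (Z2 m)) : flag n s -> wt (last (zvec m) s) = n.
Proof.
case/andP=> _; case: n s => [|n] s /forallP ws.
  by rewrite tuple0 /= /wt big1 // => i _; rewrite ffunE.
by have := ws ord_max; rewrite -nth_last size_tuple => /eqP.
Qed.

Lemma flag_rcons n (s : n.-tuple (Z2 m)) w :
  flag n.+1 (rcons s w) = [&& flag n s, psucc w (last (zvec m) s) & wt w == n.+1].
Proof.
rewrite /flag rcons_path; move: (path _ _ _) (psucc w _) => p q; rewrite -!andbA.
congr (_ && _); rewrite andbCA; congr (_ && _); apply/forallP/andP => [ws|[/forallP ws ww] j].
  split; last by have := ws ord_max; rewrite nth_rcons size_tuple ltnn eqxx.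
  apply/forallP => j; have := ws (widen_ord (leqnSn n) j).
  by rewrite nth_rcons size_tuple /= ltn_ord.
rewrite nth_rcons size_tuple; have := ltn_ord j; rewrite ltnS leq_eqVlt.
case: ltngtP => // [jn _|-> _]; last by [].
exact: (ws (Ordinal jn)).
Qed.

(** Remove the last vertex [w]: it contributes the factor 1/gamma_w, and the rest is a chain ending
    at some [flip l w] with [w l]. *)
Lemma flag_sumS n w : wt w = n.+1 ->
  flag_sum n.+1 w = (gamma a c w)^-1 * \sum_(l | w l) flag_sum n (flip l w).
Proof.
move=> wn; rewrite /flag_sum.
pose rc (p : n.-tuple (Z2 m) * Z2 m) : n.+1.-tuple (Z2 m) := [tuple of rcons p.1 p.2].
(* Appending is injective between finite sets of the same cardinality. *)
have rc_bij : bijective rc.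
  apply: inj_card_bij; last by rewrite card_prod !card_tuple expnSr.
  by move=> [s x] [s' x'] /(congr1 val)/= /rcons_inj[/val_inj -> ->].
rewrite (reindex rc) /=; last exact: onW_bij.
under eq_bigl => p do rewrite flag_rcons last_rcons.
transitivity (\sum_(s : n.-tuple (Z2 m) | flag n s && psucc w (last (zvec m) s))
   (gamma a c w)^-1 * (\prod_(u <- s) gamma a c u)^-1).
  transitivity (\sum_(s : n.-tuple (Z2 m))
      \sum_(x | [&& flag n s, psucc x (last (zvec m) s) & wt x == n.+1] && (x == w))
        (\prod_(u <- rcons s x) gamma a c u)^-1).
    by rewrite pair_big_dep.
  rewrite [RHS]big_mkcond; apply: eq_bigr => s _ /=.
  case: ifP => [/andP[fs ps]|fps].
    rewrite (big_pred1 w) => [|x].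
      by rewrite -cats1 big_cat big_seq1 invfM mulrC.
    rewrite fs /=; case: (eqVneq x w) => [->|_]; last by rewrite andbF.
    by rewrite ps wn eqxx.
  rewrite big_pred0 // => x; case: (eqVneq x w) => [->|_]; last by rewrite andbF.
  by rewrite andbT andbA fps.
rewrite -mulr_sumr; congr (_ * _).
(* Sum over chains first: a given chain ends at [flip l w] for exactly one [l] if [w] covers its
   last vertex, and for none otherwise. *)
rewrite (exchange_big_dep (fun s : n.-tuple (Z2 m) => flag n s)) /=; last first.
  by move=> l s _ /andP[].
rewrite big_mkcondr; apply: eq_bigr => s fs; rewrite fs /=.
by rewrite sum_psucc // (wt_last_flag fs).
Qed.

Lemma gamma_zvec : gamma a c (zvec m) = a.
Proof.
by rewrite /gamma /wt !big1 ?addr0 ?subr0 // => i _; rewrite ffunE ?mul0r.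
Qed.

Lemma Acoef0 : Acoef a c (zvec m) = 1.
Proof.
have w0 : wt (zvec m) = 0%N by rewrite /wt big1 // => i _; rewrite ffunE.
rewrite AcoefE w0 /flag_sum (big_pred1 [tuple]) ?big_nil ?invr1 // => s.
by rewrite tuple0 /flag /= !eqxx andbT; apply/forallP => -[].
Qed.

(** At zero this is gamma_0 = a and A_0 = 1; elsewhere it is [flag_sumS] cleared of its
    denominator. *)
Lemma gamma_Acoef w : gamma a c w != 0 ->
  gamma a c w * Acoef a c w - \sum_(l | w l) Acoef a c (flip l w) = a * (w == zvec m)%:R.
Proof.
move=> gw; case: (eqVneq w (zvec m)) => [->|w0].
  by rewrite Acoef0 gamma_zvec big_pred0 => [|l]; [rewrite subr0 | rewrite ffunE].
rewrite mulr0; have [n wn] : exists n, wt w = n.+1.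
  case wn : (wt w) => [|n]; last by exists n.
  case/eqP: w0; apply/esym/eq_of_wt => [i|]; first by rewrite ffunE.
  by rewrite wn /wt big1 // => i _; rewrite ffunE.
rewrite AcoefE wn flag_sumS // mulVKf //; apply/eqP; rewrite subr_eq0; apply/eqP.
apply: eq_bigr => l wl; rewrite AcoefE; congr flag_sum.
by apply: succn_inj; rewrite -wn; exact: wt_flip.
Qed.

End Chains.

(** * The product of C with the vectors f_v *)

Section CMatrix.
Variables (K : fieldType) (m : nat) (a : K) (b c : 'I_m -> K).
Hypotheses (beta0 : forall e i, beta b c e i != 0) (gamma0 : forall v, gamma a c v != 0).
Hypothesis a0 : a != 0.
Implicit Types (u v w : Z2 m) (l : 'I_m).

Definition Cterm w v u : K := \prod_(i | ~~ w i) ((v i == u i)%:R / beta b c (v i) i).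

Lemma Cterm_flip_in l w v u : w l -> Cterm w v (flip l u) = Cterm w v u.
Proof.
move=> wl; apply: eq_bigr => i wi; rewrite flip_off //.
by apply: contraNneq wi => ->.
Qed.

(** Exactly one of [u l] and [~~ u l] equals [v l]; in that summand the beta cancels the factor at
    [l]. What is left is the product over the zeros of [w] other than [l], which are the zeros of
    [flip l w]. *)
Lemma Cterm_flip_out l w v u : ~~ w l ->
  beta b c (u l) l * Cterm w v u + beta b c (~~ u l) l * Cterm w v (flip l u)
  = Cterm (flip l w) v u.
Proof.
move=> wl.
have E x : Cterm w v x = (v l == x l)%:R / beta b c (v l) l * Cterm (flip l w) v x.
  rewrite /Cterm (bigD1 l) //=; congr (_ * _); apply: eq_bigl => i.
  rewrite ffunE; case: eqP => [->|_]; first by rewrite negbK (negPf wl) andbF.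
  by rewrite andbT.
rewrite !E flip_at Cterm_flip_in ?flip_at // !mulrA -mulrDl.
have := beta0 (v l) l; case: (v l); case: (u l) => /= bl;
  by rewrite ?(mul0r, mulr0, add0r, addr0, mulr1) divff // mul1r.
Qed.

Lemma beta_sum (e : bool) l : beta b c e l + beta b c (~~ e) l = c l - 1.
Proof. by case: e; rewrite /beta /=; ring. Qed.

(** Split the coordinates by [w l]. Where it is 1, [Cterm] does not see the flip, and beta_0 +
    beta_1 = c_l - 1 accumulates to gamma_w; where it is 0, [Cterm_flip_out] applies. *)
Lemma Cterm_sum w v u :
  (a - sumbeta b c u) * Cterm w v u - \sum_l beta b c (~~ u l) l * Cterm w v (flip l u)
  = gamma a c w * Cterm w v u - \sum_(l | ~~ w l) Cterm (flip l w) v u.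
Proof.
have -> : gamma a c w = a - \sum_(l | w l) (c l - 1).
  rewrite /gamma sumrB opprB -addrA; congr (_ + _); rewrite [RHS]addrC.
  rewrite /wt natr_sum [in RHS]big_mkcond [X in _ = _ + X]big_mkcond /=.
  by congr (- _ + _); apply: eq_bigr => l _; case: (w l); rewrite ?mul1r ?mul0r.
rewrite !mulrBl -!addrA; congr (_ + _); rewrite -!opprD; congr (- _).
rewrite /sumbeta !mulr_suml -big_split /= (bigID (fun l => w l)) /=; congr (_ + _).
  by apply: eq_bigr => l wl; rewrite Cterm_flip_in // -mulrDl beta_sum.
by apply: eq_bigr => l wl; exact: Cterm_flip_out.
Qed.

Lemma Ccoef_sum v u :
  (a - sumbeta b c u) * Ccoef a b c v u - \sum_l beta b c (~~ u l) l * Ccoef a b c v (flip l u)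
  = a * (v == u)%:R / prodbeta b c u.
Proof.
transitivity (\sum_w Acoef a c w * (gamma a c w * Cterm w v u
                                    - \sum_(l | ~~ w l) Cterm (flip l w) v u)).
  under [RHS]eq_bigr => w _ do rewrite -Cterm_sum mulrBr mulrCA.
  rewrite sumrB -mulr_sumr; congr (_ - _).
  under [LHS]eq_bigr => l _ do rewrite mulr_sumr.
  rewrite exchange_big; apply: eq_bigr => w _; rewrite mulr_sumr.
  by apply: eq_bigr => l _; rewrite mulrCA.
under eq_bigr => w _ do rewrite mulrBr mulr_sumr mulrA.
rewrite sumrB (exchange_big_dep predT) //=.
(* Reindex by [flip l], so that A_w G_(sigma_l w) over [w l = 0] becomes A_(sigma_l w) G_w over
   [w l = 1], as in the recursion for A_w. *)
under [X in _ - X]eq_bigr => l _.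
  rewrite (reindex_inj (inv_inj (flipK l))).
  under eq_bigl => w do rewrite flip_at negbK.
  under eq_bigr => w _ do rewrite flipK.
  over.
rewrite (exchange_big_dep predT) //= -sumrB.
transitivity (\sum_w a * (w == zvec m)%:R * Cterm w v u).
  apply: eq_bigr => w _; rewrite -(gamma_Acoef (gamma0 w)) -mulr_suml -mulrBl.
  by congr ((_ - _) * _); exact: mulrC.
rewrite (bigD1 (zvec m)) //= big1 => [|w /negPf ->]; last by rewrite mulr0 mul0r.
rewrite eqxx mulr1 addr0 -mulrA; congr (_ * _).
(* Only [w = 0] is left; its product runs over all coordinates and is delta(v,u) divided by
   [prodbeta u]. *)
rewrite /Cterm; under eq_bigl => i do rewrite ffunE.
case: (eqVneq v u) => [->|vu].
  by rewrite mul1r /prodbeta -prodfV; apply: eq_bigr => i _; rewrite eqxx mul1r.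
rewrite mul0r; have [i vui|E] := pickP (fun i => v i != u i); last first.
  by case/eqP: vu; apply/ffunP => i; have /negbFE/eqP := E i.
by rewrite (bigD1 i) //= (negPf vui) !mul0r.
Qed.

(** The entry form of this is [Ccoef_sum] divided by [a]. It makes each product of C with some f_v
    in [Xi] supported on a single row. *)
Lemma Cmx_fvec u : Cmx a b c *m (fvec a b c u)^T = (prodbeta b c u)^-1 *: (evec K u)^T.
Proof.
(* Pairing with a unit vector selects an entry; this turns the matrix product with [fvec] into
   values of [Ccoef]. *)
have sum_evec (f : Z2 m -> K) w : \sum_k f (vtx k) * evec K w 0 k = f w.
  under eq_bigr do rewrite mxE.
  rewrite (sum_vtx (fun v => f v * (v == w)%:R)) (bigD1 w) //= eqxx mulr1.
  by rewrite big1 ?addr0 // => v /negPf ->; rewrite mulr0.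
apply/matrixP => i z; rewrite ord1 !mxE.
pose C v := Ccoef a b c (vtx i) v.
transitivity ((a - sumbeta b c u) / a * C u - \sum_l beta b c (~~ u l) l / a * C (flip l u)).
  rewrite -(sum_evec C u); under [X in _ - X]eq_bigr => l _ do rewrite -(sum_evec C).
  rewrite mulr_sumr.
  under [X in _ - X]eq_bigr => l _ do rewrite mulr_sumr.
  rewrite exchange_big -sumrB; apply: eq_bigr => k _ /=.
  rewrite !mxE mulrBr mulrCA; congr (_ - _).
  rewrite summxE mulr_sumr; apply: eq_bigr => l _.
  by rewrite !mxE mulrCA.
apply: (mulfI a0).
transitivity ((a - sumbeta b c u) * C u - \sum_l beta b c (~~ u l) l * C (flip l u)).
  rewrite mulrBr; congr (_ - _); first by rewrite mulrA [a * (_ / _)]mulrCA divff // mulr1.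
  rewrite mulr_sumr; apply: eq_bigr => l _.
  by rewrite mulrA [a * (_ / _)]mulrCA divff // mulr1.
by rewrite Ccoef_sum -mulrA; congr (_ * _); rewrite mulrC.
Qed.

End CMatrix.

(** * Entries of the coefficient matrices of Xi *)

Section XiEntries.
Variables (K : fieldType) (m : nat) (a : K) (b c : 'I_m -> K).
Hypotheses (beta0 : forall e i, beta b c e i != 0) (gamma0 : forall v, gamma a c v != 0).
Hypothesis a0 : a != 0.
Implicit Types (u v w : Z2 m) (k l : 'I_m).

Lemma prodbeta_neq0 v : prodbeta b c v != 0.
Proof. by apply/prodf_neq0 => i _; exact: beta0. Qed.

(** Both sides are beta_0 beta_1 at [k] times the product over the other coordinates. *)
Lemma prodbeta_flip k v :
  prodbeta b c (flip k v) * beta b c (v k) k = prodbeta b c v * beta b c (~~ v k) k.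
Proof.
rewrite /prodbeta (bigD1 k) //= [in RHS](bigD1 k) //= flip_at.
under eq_bigr => i ik do rewrite flip_off //.
by ring.
Qed.

Lemma Xi_dlog_entry v i j :
  ((- a * prodbeta b c v) *: (Cmx a b c *m (fvec a b c v)^T *m fvec a b c v)) i j
  = - (vtx i == v)%:R * (a * fvec a b c v 0 j).
Proof.
rewrite Cmx_fvec // -scalemxAl scalerA mulfK ?prodbeta_neq0 //.
by rewrite mxE mxE big_ord1 !mxE !mulNr mulrCA.
Qed.

(** By [Cmx_fvec], row [v] receives a contribution only from the [u] with [u k = 0] among [v] and
    [flip k v]. The scalar part is 1 - c_k = -(beta_0 + beta_1), and it combines with this single
    term. *)
Lemma Xi_dx_entry k i j (v := vtx i) :
  ((1 - c k)%:M + \sum_(u : Z2 m | ~~ u k) (beta b c true k * prodbeta b c u) *: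
     (Cmx a b c *m (fvec a b c u - fvec a b c (flip k u))^T
        *m (evec K u - evec K (flip k u)))) i j
  = - (beta b c (v k) k * evec K v 0 j + beta b c (~~ v k) k * evec K (flip k v) 0 j).
Proof.
have uE u : ~~ u k -> ((beta b c true k * prodbeta b c u) *:
     (Cmx a b c *m (fvec a b c u - fvec a b c (flip k u))^T
        *m (evec K u - evec K (flip k u)))) i j
   = (beta b c true k * (v == u)%:R - beta b c false k * (v == flip k u)%:R)
     * (evec K u 0 j - evec K (flip k u) 0 j).
  move=> uk; rewrite [(_ - _)^T]linearB [Cmx _ _ _ *m _]mulmxBr !Cmx_fvec //.
  rewrite mxE mxE big_ord1 mulrA.
  rewrite [(evec K u - _) 0 j]mxE [(- evec K _) 0 j]mxE; congr (_ * _).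
  (* Since [u k = 0], [prodbeta_flip] turns beta_1 times the quotient of [prodbeta u] by
     [prodbeta (flip k u)] into beta_0. *)
  rewrite !mxE -/v; have := prodbeta_flip k u; rewrite (negPf uk) /=.
  have := prodbeta_neq0 u; have := prodbeta_neq0 (flip k u).
  move: (prodbeta b c u) (prodbeta b c (flip k u)) => p p' p'0 p0 pE.
  rewrite mulrBr; congr (_ - _); first by rewrite mulrA mulfK.
  by rewrite mulrA; congr (_ * _); rewrite [_ * p]mulrC -pE mulrC mulKf.
rewrite mxE summxE (eq_bigr _ uE) mxE.
have -> : (1 - c k) *+ (i == j) = (1 - c k) * evec K v 0 j.
  by rewrite mxE (inj_eq (@vtx_inj m)) eq_sym mulr_natr.
have fk u : (v == flip k u) = (u == flip k v).
  by rewrite -(inj_eq (inv_inj (flipK k))) flipK eq_sym.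
have bc := beta_sum b c false k; rewrite /= in bc.
have -> : 1 - c k = - (beta b c false k + beta b c true k) by rewrite bc opprB.
(* The contributing index is [flip k v] if [v k], and [v] itself otherwise. *)
case vk: (v k) => /=.
  rewrite (bigD1 (flip k v)) ?flip_at ?vk //= big1 => [|u /andP[uk /negPf uv]].
    rewrite fk eqxx flipK; case: eqP => [E|_]; last by rewrite addr0 /=; ring.
    by have := flip_at k v; rewrite -E vk.
  rewrite fk uv; case: eqP => [E|_]; last by rewrite mulr0 mulr0 subr0 mul0r.
  by move: uk; rewrite -E vk.
rewrite (bigD1 v) ?vk //= big1 => [|u /andP[uk uv]].
  rewrite eqxx; case: eqP => [E|_]; last by rewrite addr0 /=; ring.
  by have := flip_at k v; rewrite -E vk.
rewrite eq_sym (negPf uv) fk; case: eqP => [E|_]; last by rewrite !mulr0 subr0 mul0r.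
by move: uk; rewrite E flip_at vk.
Qed.

End XiEntries.

(** * The connection matrix *)

Section Functions.
Variables (K : fieldType) (m : nat) (a : K) (b c : 'I_m -> K).
Local Notation F := (ratfun K m).
Local Notation form := (Defs.form K m).
Implicit Types (j : 'I_(m + m)) (i k l : 'I_m) (v : Z2 m) (u w : form) (f g : F).

Definition phi_coef v : F := (\prod_i (tvar K i - (v i)%:R))^-1.

(** This is g_i = (t_i - v_i) p_v, written without the factor at [i] so that its independence of t_i
    is visible. *)
Definition phi_facet v i : F := (\prod_(l | l != i) (tvar K l - (v l)%:R))^-1.

Lemma phi_coefE v i : phi_coef v = phi_facet v i / (tvar K i - (v i)%:R).
Proof. by rewrite /phi_coef (bigD1 i) //= invfM mulrC. Qed.

Lemma phi_facet_flip v i : phi_facet (flip i v) i = phi_facet v i.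
Proof. by congr _^-1; apply: eq_bigr => l li; rewrite flip_off. Qed.

Lemma tvar_sub_neq0 v i : tvar K i - (v i)%:R != 0.
Proof.
case: (v i); last by rewrite subr0; exact: zvar_neq0.
by rewrite -opprB oppr_eq0; exact: one_minus_t_neq0.
Qed.

Lemma regular_tvar_subV v i : regular (tvar K i - (v i)%:R)^-1.
Proof.
case: (v i); first exact: regular_t1V.
by rewrite subr0; have [] := regular_t_one_minus_tV K i.
Qed.

Lemma regular_phi_facet v i : regular (phi_facet v i).
Proof. by rewrite /phi_facet -prodfV; apply: regular_prod => l _; exact: regular_tvar_subV. Qed.

Lemma pderiv_prod (I : finType) (P : pred I) (E : I -> F) j :
  (forall s, P s -> pderiv j (E s) = 0) -> pderiv j (\prod_(s | P s) E s) = 0.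
Proof.
move=> E0; apply: (big_ind (fun f => pderiv j f = 0)) => [|f g f0 g0|l]; last exact: E0.
  exact: (pderiv_nat _ _ 1).
by rewrite pderivM f0 g0 mul0r mulr0 addr0.
Qed.

Lemma pderiv_inv0 j f : pderiv j f = 0 -> pderiv j f^-1 = 0.
Proof. by move=> f0; rewrite pderivV f0 oppr0 mul0r. Qed.

Lemma pderiv_phi_facet v i : pderiv (lshift m i) (phi_facet v i) = 0.
Proof.
apply: pderiv_inv0; apply: pderiv_prod => l li.
by rewrite (raddfB (pderiv _)) /= pderiv_t_t pderiv_nat eq_sym (negPf li) subrr.
Qed.

Lemma pderiv_x_phi_coef v k : pderiv (rshift m k) (phi_coef v) = 0.
Proof.
apply: pderiv_inv0; apply: pderiv_prod => l _.
by rewrite (raddfB (pderiv _)) /= pderiv_x_t pderiv_nat subrr.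
Qed.

Definition phi_boundary v i : F :=
  cst m (beta b c (v i) i) * phi_coef v + cst m (beta b c (~~ v i) i) * phi_coef (flip i v).

(** The derivative of [phi_facet] vanishes, so only multiplication by omega remains; dividing
    [phi_facet] by t_i and by t_i - 1 gives p_v and p_(sigma_i v), in the order fixed by [v i]. *)
Lemma nab_phi_facet v i : nab a b c (lshift m i) (phi_facet v i) =
  phi_boundary v i + cst m a * xvar K i / one_minus_tx K m * phi_facet v i.
Proof.
rewrite /nab /phi_boundary pderiv_phi_facet add0r omega_t.
rewrite (phi_coefE v i) (phi_coefE (flip i v) i).
rewrite phi_facet_flip flip_at mulrDl; congr (_ + _).
rewrite [phi_facet v i / _]mulrC [phi_facet v i / _]mulrC !mulrA -mulrDl.
by case: (v i) => /=; rewrite subr0 // [RHS]mulrC [LHS]mulrC addrC.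
Qed.

Lemma mul_x_phi_facet v :
  \sum_i xvar K i * phi_facet v i = phi_coef v * (one_minus_vx K v - one_minus_tx K m).
Proof.
rewrite one_minus_vx_sub_tx mulr_sumr; apply: eq_bigr => i _; rewrite (phi_coefE v i) mulrCA.
by rewrite divfK ?tvar_sub_neq0.
Qed.

(** The algebra of [connection_coef] in free variables: T is 1 - t.x, q is 1 - v.x, e is v_k, p is
    p_v, B and S are the boundary term at k and the sum of all of them, and gk is [phi_facet] at
    k. *)
Lemma connection_coef_eq (L : fieldType) (A t T p B x e q S gk : L) :
  x != 0 -> T != 0 -> q != 0 -> gk = (t - e) * p ->
  A * t / T * p + (B / x - e / q * (A * p - S))
  = x^-1 * (B + A * x / T * gk) + e / q * (S + A / T * (p * (q - T))).
Proof. by move=> x0 T0 q0 ->; field; rewrite x0 T0 q0. Qed.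

(** The left side is the coefficient of dx_k in [nablaX] of phi_v minus row v of Xi Phi. The right
    side exhibits it as a sum of D_(t_i) g_i with coefficients free of t, hence as exact. *)
Lemma connection_coef v k :
  omega a b c (rshift m k) * phi_coef v
  + (phi_boundary v k / xvar K k
     - (v k)%:R / one_minus_vx K v * (cst m a * phi_coef v - \sum_i phi_boundary v i))
  = \sum_i ((i == k)%:R / xvar K k + (v k)%:R / one_minus_vx K v)
           * nab a b c (lshift m i) (phi_facet v i).
Proof.
transitivity ((xvar K k)^-1 * nab a b c (lshift m k) (phi_facet v k)
  + (v k)%:R / one_minus_vx K v * \sum_i nab a b c (lshift m i) (phi_facet v i)); last first.
  under [RHS]eq_bigr => i _ do rewrite mulrDl.
  rewrite [RHS]big_split /= mulr_sumr; congr (_ + _).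
  rewrite (bigD1 k) //= eqxx mul1r big1 ?addr0 // => i /negPf ->.
  by rewrite !mul0r.
have -> : \sum_i nab a b c (lshift m i) (phi_facet v i) = \sum_i phi_boundary v i
  + cst m a / one_minus_tx K m * (phi_coef v * (one_minus_vx K v - one_minus_tx K m)).
  rewrite -mul_x_phi_facet mulr_sumr -big_split; apply: eq_bigr => i _ /=.
  by rewrite nab_phi_facet [cst m a * _ / _]mulrAC !mulrA.
rewrite nab_phi_facet.
rewrite omega_x; apply: connection_coef_eq.
- exact: zvar_neq0.
- exact: one_minus_tx_neq0.
- exact: one_minus_vx_neq0.
- by rewrite (phi_coefE v k) mulrC divfK ?tvar_sub_neq0.
Qed.

End Functions.

(** * Exactness of the difference and assembly of the formula *)

Section Exactness.
Variables (K : fieldType) (m : nat) (a : K) (b c : 'I_m -> K).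
Local Notation F := (ratfun K m).
Local Notation form := (Defs.form K m).
Implicit Types (j : 'I_(m + m)) (i k l : 'I_m) (v : Z2 m) (u w : form) (f g : F).

Lemma formZE f w (J : {set 'I_(m + m)}) : (f *: w) J = f * w J.
Proof. by rewrite ffunE. Qed.

Lemma pderiv_formE j w (J : {set 'I_(m + m)}) : pderiv_form j w J = pderiv j (w J).
Proof. by rewrite ffunE. Qed.

Lemma nab_formE j w (J : {set 'I_(m + m)}) : nab_form a b c j w J = nab a b c j (w J).
Proof. by rewrite ffunE. Qed.

Lemma pderiv_dT j (J : {set 'I_(m + m)}) : pderiv j (dT K m J : F) = 0.
Proof.
have [n ->] := dT_dzset K m.
have -> : ((-1) ^+ n *: dzset K (tset m)) J = cst m ((-1) ^+ n * (J == tset m)%:R).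
  by rewrite rmorphM rmorph_sign rmorph_nat ffunE dzsetE.
exact: pderiv_cst.
Qed.

Lemma nab_formZ j g w : (forall J : {set 'I_(m + m)}, pderiv j (w J : F) = 0) ->
  nab_form a b c j (g *: w) = nab a b c j g *: w.
Proof.
move=> w0; apply/ffunP => J.
rewrite nab_formE; apply: (etrans (congr1 (nab a b c j) (formZE g w J))).
apply/esym; apply: (etrans (formZE _ w J)).
by rewrite /nab pderivM w0 mulr0 addr0 mulrDl mulrA.
Qed.

Lemma nablaT_dzwedge_x k w :
  nablaT a b c (dzwedge (rshift m k) w) = - dzwedge (rshift m k) (nablaT a b c w).
Proof.
rewrite !nablaTE raddf_sum -sumrN; apply: eq_bigr => i _ /=.
by rewrite nab_dzwedge dzwedge_anticomm.
Qed.

Lemma exactT_sum (I : finType) q (W : I -> form) :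
  (forall s, exactT a b c q (W s)) -> exactT a b c q (\sum_s W s).
Proof.
move=> hW; apply: (big_ind (exactT a b c q)) => [|u w|l _]; last exact: hW.
  by exists 0; [exact: Omega0 | rewrite raddf0].
exact: exactTD.
Qed.

Lemma exactT_dzwedge_x k w : exactT a b c 0 w -> exactT a b c 1 (dzwedge (rshift m k) w).
Proof.
move=> [eta heta <-]; exists (- dzwedge (rshift m k) eta).
  by apply: OmegaN; exact: Omega_dzwedge_x.
by rewrite raddfN /= nablaT_dzwedge_x opprK.
Qed.

(** The primitive is [f * g] times the contraction [eta] at [i]; [f] does not depend on t_i, so it
    commutes with D_(t_i). *)
Lemma exactT_nab i f g : regular f -> regular g -> pderiv (lshift m i) f = 0 ->
  exactT a b c 0 ((f * nab a b c (lshift m i) g) *: dT K m).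
Proof.
move=> rf rg f0; have [eta [eta0 heta etaE]] := dT_contraction K i.
exists ((f * g) *: eta); first exact: OmegaZ (regularM rf rg) heta.
rewrite nablaTE (bigD1 i) //= big1 ?addr0 => [|l li].
  rewrite nab_formZ // dzwedgeZ etaE eqxx scale1r; congr (_ *: _).
  by rewrite /nab pderivM f0 mul0r add0r (mulrCA _ f) -mulrDr.
by rewrite nab_formZ // dzwedgeZ etaE eq_sym (negPf li) scale0r scaler0.
Qed.

Lemma dz_pderiv_fun_form j g :
  wedge (dzset K [set j]) (pderiv_form j (fun_form g)) = pderiv j g *: dzset K [set j].
Proof.
have -> : pderiv_form j (fun_form g) = pderiv j g *: dzset K set0.
  apply/ffunP => J.
  rewrite pderiv_formE; apply: (etrans (congr1 (pderiv j) (formZE g _ J))).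
  apply/esym; apply: (etrans (formZE _ _ J)).
  by rewrite pderivM (pderiv_dzset K j set0 J) mulr0 addr0.
have j0 : j \notin set0 by rewrite in_set0.
have i0 : inversions [set j] set0 = 0.
  by rewrite inversions1l; apply/eqP; rewrite cards_eq0; apply/eqP/setP => l; rewrite !inE.
by rewrite -/(dzwedge _ _) dzwedgeZ (dzwedge_dzset K j0) setU0 i0 expr0 scale1r.
Qed.

(** The t-derivatives vanish. At [v = 0] all coefficients are 0, in agreement with the convention on
    that form. *)
Lemma dlog_one_minus_vx v :
  dlog (one_minus_vx K v) = \sum_i (- (v i)%:R / one_minus_vx K v) *: dx K i.
Proof.
have eT : extT (fun_form (one_minus_vx K v)) = 0.
  rewrite /extT; apply: big1 => i _; apply: (etrans (dz_pderiv_fun_form _ _)).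
  by rewrite pderiv_t_one_minus_vx scale0r.
have eX : extX (fun_form (one_minus_vx K v)) = \sum_i (- (v i)%:R) *: dx K i.
  apply: eq_bigr => i _; apply: (etrans (dz_pderiv_fun_form _ _)).
  by rewrite pderiv_x_one_minus_vx.
rewrite /dlog eT eX add0r scaler_sumr; apply: eq_bigr => i _.
by rewrite scalerA mulrC.
Qed.

Lemma tensorD (M N : 'M[K]_(2 ^ m)) w : tensor (M + N) w = tensor M w + tensor N w.
Proof.
apply/matrixP => r s; rewrite mxE [RHS]mxE [tensor M w r s]mxE [tensor N w r s]mxE.
by rewrite [(M + N) r s]mxE rmorphD scalerDl.
Qed.

Lemma tensor0 w : tensor (0 : 'M[K]_(2 ^ m)) w = 0.
Proof. by apply/matrixP => r s; rewrite !mxE rmorph0 scale0r. Qed.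

Hypotheses (beta0 : forall e i, beta b c e i != 0) (gamma0 : forall v, gamma a c v != 0).
Hypothesis a0 : a != 0.

Lemma tensorE (M : 'M[K]_(2 ^ m)) w r s : tensor M w r s = cst m (M r s) *: w.
Proof. by rewrite mxE. Qed.

Lemma Xi_dx_coef r s k :
  tensor ((1 - c k)%:M + \sum_(u : Z2 m | ~~ u k) (beta b c true k * prodbeta b c u) *:
     (Cmx a b c *m (fvec a b c u - fvec a b c (flip k u))^T
        *m (evec K u - evec K (flip k u)))) ((xvar K k)^-1 *: dx K k) r s
  = - (cst m (beta b c (vtx r k) k * evec K (vtx r) 0 s
                     + beta b c (~~ vtx r k) k * evec K (flip k (vtx r)) 0 s) / xvar K k)
    *: dx K k.
Proof.
rewrite tensorE (Xi_dx_entry beta0 gamma0 a0) scalerA rmorphN.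
by congr (_ *: _); exact: mulNr.
Qed.

Lemma mulNN_eq (L : comPzRingType) (x y z : L) : - x * (- y * z) = y * z * x.
Proof. by ring. Qed.

Lemma Xi_dlog_coef r s :
  (\sum_(v : Z2 m) tensor ((- a * prodbeta b c v) *:
                (Cmx a b c *m (fvec a b c v)^T *m fvec a b c v))
             (dlog (one_minus_vx K v))) r s
  = \sum_k ((vtx r k)%:R / one_minus_vx K (vtx r) * cst m (a * fvec a b c (vtx r) 0 s))
     *: dx K k.
Proof.
rewrite summxE (bigD1 (vtx r)) //= [X in _ + X]big1 ?addr0 => [|v vi]; last first.
  rewrite tensorE (Xi_dlog_entry beta0 gamma0 a0) eq_sym (negPf vi) oppr0 mul0r rmorph0.
  exact: scale0r.
rewrite tensorE (Xi_dlog_entry beta0 gamma0 a0) eqxx mulN1r dlog_one_minus_vx scaler_sumr.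
apply: eq_bigr => k _; rewrite scalerA rmorphN; congr (_ *: _).
exact: mulNN_eq.
Qed.

Lemma XiE r s : Xi a b c r s =
  \sum_k (- (cst m (beta b c (vtx r k) k * evec K (vtx r) 0 s
                     + beta b c (~~ vtx r k) k * evec K (flip k (vtx r)) 0 s) / xvar K k)
          + (vtx r k)%:R / one_minus_vx K (vtx r) * cst m (a * fvec a b c (vtx r) 0 s))
         *: dx K k.
Proof.
rewrite /Xi -big_split /=.
under eq_bigr => k _ do
  rewrite -(big_morph _ (fun M N => tensorD M N _) (tensor0 _)) -tensorD.
rewrite mxE Xi_dlog_coef summxE.
rewrite (eq_bigr _ (fun k _ => Xi_dx_coef r s k)) -big_split.
by apply: eq_bigr => k _; exact: esym (scalerDl _ _ _).
Qed.

(** The coefficient of dT in the product of the constant row [x] with Phi. *)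
Definition row_form (x : 'rV[K]_(2 ^ m)) : F := \sum_s cst m (x 0 s) * phi_coef K (vtx s).

Lemma row_form_is_zmod : GRing.zmod_morphism row_form.
Proof.
move=> x y; rewrite /row_form -sumrB; apply: eq_bigr => s _.
by rewrite mxE [(- y) _ _]mxE rmorphB mulrBl.
Qed.
HB.instance Definition _ :=
  GRing.isZmodMorphism.Build 'rV[K]_(2 ^ m) F row_form row_form_is_zmod.

Lemma row_formZ (z : K) x : row_form (z *: x) = cst m z * row_form x.
Proof.
rewrite /row_form mulr_sumr; apply: eq_bigr => s _.
by rewrite mxE rmorphM -mulrA.
Qed.

Lemma row_form_evec v : row_form (evec K v) = phi_coef K v.
Proof.
rewrite /row_form; under eq_bigr do rewrite mxE.
rewrite (sum_vtx (fun v' : Z2 m => cst m (v' == v)%:R * phi_coef K v')) (bigD1 v) //=.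
rewrite eqxx rmorph1 mul1r big1 ?addr0 // => v' /negPf ->.
by rewrite rmorph0 mul0r.
Qed.

(** Each beta_(v_i,i) p_v in the diagonal term of a f_v joins the flipped term at i to form
    [phi_boundary]. *)
Lemma row_form_fvec v : row_form (a *: fvec a b c v)
  = cst m a * phi_coef K v - \sum_i phi_boundary b c v i.
Proof.
have -> : a *: fvec a b c v = (a - sumbeta b c v) *: evec K v
    - \sum_l beta b c (~~ v l) l *: evec K (flip l v).
  rewrite /fvec scalerBr scalerA mulrCA divff // mulr1 scaler_sumr; congr (_ - _).
  by apply: eq_bigr => l _; rewrite scalerA mulrCA divff // mulr1.
rewrite (raddfB row_form) (raddf_sum row_form) /= row_formZ row_form_evec.
under [X in _ - X]eq_bigr => l _ do rewrite row_formZ row_form_evec.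
rewrite rmorphB mulrBl -addrA -opprD; congr (_ - _).
rewrite /sumbeta rmorph_sum mulr_suml.
by rewrite -big_split.
Qed.

Lemma wedgemx_Xi_Phi r : wedgemx (Xi a b c) (Phi K m) r 0 =
  \sum_k dzwedge (rshift m k)
    ((- (phi_boundary b c (vtx r) k / xvar K k)
      + (vtx r k)%:R / one_minus_vx K (vtx r)
        * (cst m a * phi_coef K (vtx r) - \sum_l phi_boundary b c (vtx r) l)) *: dT K m).
Proof.
rewrite mxE; under eq_bigr => s _ do rewrite XiE wedge_suml.
rewrite exchange_big; apply: eq_bigr => k _ /=.
pose e : 'rV[K]_(2 ^ m) := beta b c (vtx r k) k *: evec K (vtx r)
  + beta b c (~~ vtx r k) k *: evec K (flip k (vtx r)).
pose f : 'rV[K]_(2 ^ m) := a *: fvec a b c (vtx r).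
pose Y s : F := - (cst m (e 0 s) / xvar K k)
  + (vtx r k)%:R / one_minus_vx K (vtx r) * cst m (f 0 s).
transitivity (\sum_s dzwedge (rshift m k) ((Y s * phi_coef K (vtx s)) *: dT K m)).
  apply: eq_bigr => s _; rewrite wedgeZl.
  rewrite -scalerA (dzwedgeZ _ (Y s)) /Y; congr ((- (cst m _ / _) + _ * cst m _) *: _).
  - by rewrite /e !mxE.
  - by rewrite /f !mxE.
  - by rewrite [Phi _ _ _ _]mxE.
transitivity (dzwedge (rshift m k) (\sum_s (Y s * phi_coef K (vtx s)) *: dT K m)).
  by rewrite raddf_sum.
rewrite -scaler_suml; congr (dzwedge _ (_ *: _)).
have eE : row_form e = phi_boundary b c (vtx r) k.
  by rewrite /e (raddfD row_form) /= !row_formZ !row_form_evec.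
rewrite -eE -row_form_fvec /row_form.
rewrite mulr_suml mulr_sumr -sumrN -big_split; apply: eq_bigr => s _ /=.
by rewrite /Y mulrDl mulNr mulrAC mulrA.
Qed.

Lemma nablaX_phi v : nablaX a (phi K v) =
  \sum_k dzwedge (rshift m k) ((omega a b c (rshift m k) * phi_coef K v) *: dT K m).
Proof.
rewrite (nablaXE a b c); apply: eq_bigr => k _.
rewrite /phi -/(phi_coef K v) nab_formZ => [|J]; last exact: pderiv_dT.
by rewrite /nab pderiv_x_phi_coef add0r.
Qed.

(** Stated over any field with the beta, the gamma and [a] nonzero, which covers indeterminate as
    well as complex parameters. *)
Lemma connection_formula_generic : connection_formula a b c.
Proof.
move=> r; apply: nablaXH_class; rewrite mxE nablaX_phi wedgemx_Xi_Phi -sumrB.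
apply: exactT_sum => k; rewrite -(raddfB (dzwedge _)) /= -scalerBl.
apply: exactT_dzwedge_x.
rewrite opprD opprK connection_coef scaler_suml.
apply: exactT_sum => i; apply: exactT_nab.
- apply: regularD.
    apply: regularM (regular_xV _ _).
    by rewrite -(rmorph_nat (@cst K m)); exact: regular_cst.
  apply: regularM (regular_one_minus_vxV _ _).
  by rewrite -(rmorph_nat (@cst K m)); exact: regular_cst.
- exact: regular_phi_facet.
- rewrite pderivD !pderivM !pderiv_nat !mul0r !add0r.
  rewrite (pderiv_inv0 (pderiv_t_x _ _ _)) (pderiv_inv0 (pderiv_t_one_minus_vx _ _ _)).
  by rewrite !mulr0 addr0.
Qed.

End Exactness.

(** * Nonvanishing for indeterminate parameters, by specialization *)

Section Indeterminates.
Variables (k : fieldType) (m : nat).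
Local Notation N := (1 + (m + m))%N.
Local Notation a := (indet_a k m).
Local Notation b := (@indet_b k m).
Local Notation c := (@indet_c k m).

Lemma tofrac_meval_neq0 (p : {mpoly k[N]}) e : p.@[e] != 0 -> FracField.tofrac p != 0.
Proof. by rewrite tofrac_eq0; apply: contraNneq => ->; rewrite meval0. Qed.

Lemma indet_beta_neq0 (e : bool) i : beta b c e i != 0.
Proof.
case: e; rewrite /beta /indet_b /indet_c.
  rewrite -tofrac1 -!tofracB; apply: (@tofrac_meval_neq0 _ (fun=> 0)).
  by rewrite !mevalB meval1 !mevalXU sub0r subr0 oppr_eq0 oner_eq0.
by apply: (@tofrac_meval_neq0 _ (fun=> 1)); rewrite mevalXU oner_eq0.
Qed.

Lemma indet_gamma_neq0 (v : Z2 m) : gamma a c v != 0.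
Proof.
pose p : {mpoly k[N]} := 'X_(lshift (m + m) (@ord0 0))
  - \sum_i (v i)%:R * 'X_(rshift 1 (rshift m i)) + (wt v)%:R.
have -> : gamma a c v = FracField.tofrac p.
  rewrite /gamma tofracD tofracB rmorph_nat; congr (_ - _ + _).
  by rewrite rmorph_sum; apply: eq_bigr => i _; rewrite rmorphM rmorph_nat.
(* Specializing a to 1 - |v| and every other variable to 0 makes gamma_v equal to 1. *)
pose e (j : 'I_N) : k := if j == lshift (m + m) (@ord0 0) then 1 - (wt v)%:R else 0.
apply: (@tofrac_meval_neq0 _ e).
rewrite /p mevalD mevalB mevalXU rmorph_nat rmorph_sum big1 => [|i _].
  by rewrite /e eqxx subr0 subrK oner_neq0.
by rewrite /= mevalM mevalXU /e eq_rlshift mulr0.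
Qed.

Lemma indet_a_neq0 : a != 0.
Proof. by apply: (@tofrac_meval_neq0 _ (fun=> 1)); rewrite mevalXU oner_eq0. Qed.

End Indeterminates.

Theorem corollary4p2 (R : realType) (m : nat) (hm : (1 <= m)%N) :
  connection_formula (indet_a R[i] m) (@indet_b R[i] m) (@indet_c R[i] m)
  /\
  (forall (a : R[i]) (b c : 'I_m -> R[i]),
     (forall (i : 'I_m) (z : int), beta b c false i != z%:~R) ->
     (forall (i : 'I_m) (z : int), beta b c true i != z%:~R) ->
     (forall (v : Z2 m) (z : int), gamma a c v != z%:~R) ->
     connection_formula a b c).
Proof.
split.
  apply: connection_formula_generic.
  - exact: indet_beta_neq0.
  - exact: indet_gamma_neq0.
  - exact: indet_a_neq0.
move=> a b c hb0 hb1 hg; apply: connection_formula_generic => [e i|v|].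
(* Not being an integer is used at the integer 0; [a] is nonzero because it is gamma at the zero
   vertex. *)
- by case: e; [exact: (hb1 i 0) | exact: (hb0 i 0)].
- exact: (hg v 0).
- by have := hg (zvec m) 0; rewrite gamma_zvec.
Qed.
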